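(* Let $R$ be a domain and $r$ an ideal system on $R$ such that every $r$-ideal of $R$ is an ideal of $R$. The following are equivalent: \begin{enumerate} \item[(a)] $R$ is a Krull domain. \item[(b)] The monoid $\mathcal H(R)$ of nonzero principal ideals is a Krull monoid. \item[(c)] The monoid $\mathcal I^*(R)$ of invertible ideals is a Krull monoid. \item[(d)] The monoid $(\mathcal I_r^*(R),\cdot_r)$ of $r$-invertible $r$-ideals is a Krull monoid. \item[(e)] The monoid $(\mathcal I_v^*(R),\cdot_v)$ of $v$-invertible $v$-ideals is a Krull monoid. \end{enumerate} If these hold, then the inclusion $\mathcal I_r^*(R)\hookrightarrow\mathcal I_v^*(R)$ is a divisor theory, and the class group $\mathcal C(\mathcal I_r^*(R))$ is isomorphic to $\mathcal C_v(R)/\mathcal C_r(R)$. Moreover, if every class of $\mathcal C_v(R)$ contains at least one (resp. infinitely many) prime divisors, then every class of $\mathcal C(\mathcal I_r^*(R))$ contains at least one (resp. infinitely many) prime divisors.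
   Context: An ideal system $r$ on a domain $R$ is an ideal system on the monoid $R\setminus\{0\}$: a map $X\mapsto X_r$ on subsets with $X\subseteq X_r$; $X\subseteq Y_r\Rightarrow X_r\subseteq Y_r$; $aR\subseteq\{a\}_r$; $aX_r=(aX)_r$; it extends to fractional sets via $X_r=c^{-1}(cX)_r$. $r$-ideals satisfy $I_r=I$; an $r$-ideal $I$ is $r$-invertible if $(IJ)_r=R$ for some fractional $r$-ideal $J$; $\mathcal I_r^*(R)$ is the monoid of nonzero $r$-invertible $r$-ideals with $I\cdot_r J=(IJ)_r$. $v$ is the divisorial system $I_v=(R:(R:I))$; one has $\mathcal I_r^*(R)\subseteq\mathcal I_v^*(R)$. $\mathcal C_r(R)$ is the group of $r$-invertible fractional $r$-ideals modulo nonzero principal fractional ideals (so $\mathcal C_d(R)=\operatorname{Pic}(R)$, and $\mathcal C_r(R)$ is a subgroup of $\mathcal C_v(R)$). A monoid homomorphism $\varphi:H\to D$ between cancellative monoids is a divisor homomorphism if $\varphi(a)\mid\varphi(b)$ implies $a\mid b$. A Krull monoid is a cancellative monoid admitting a divisor homomorphism into a factorial monoid (equivalently, a completely integrally closed monoid with ACC on divisorial ideals); a Krull domain is a domain whose monoid $R\setminus\{0\}$ is Krull. A divisor theory is a divisor homomorphism $\varphi:H\to\mathcal F(P)$ into a free abelian monoid with basis $P$ such that every element of $\mathcal F(P)$ is a greatest common divisor of finitely many elements of $\varphi(H)$; the elements of $P$ are the prime divisors, the class group is $\mathcal C(H)=\mathsf q(\mathcal F(P))/\mathsf q(\varphi(H))$,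 and the class of $p\in P$ is its image there. For a Krull domain $R$, the prime divisors are the height-one primes $\mathfrak p$, with classes $[\mathfrak p]\in\mathcal C_v(R)$. *)

(* Defs.v *)
(* Domain R : idomainType, quotient field K := {fraction R}.
   Subsets are predicates (T -> Prop); ideals of the monoid R\{0} (and their
   fractional versions) are represented as subsets of K not containing 0. *)
From HB Require Import structures.
From mathcomp Require Import all_boot all_order all_algebra.
From mathcomp Require Import fraction.
From Stdlib Require List Permutation.

Set Implicit Arguments.
Unset Strict Implicit.
Unset Printing Implicit Defensive.

Import GRing.Theory.
Local Open Scope ring_scope.

Definition is_cmonoid (T : Type) (S : T -> Prop) (op : T -> T -> T) (e : T) :=
  [/\ S e,
      (forall a b, S a -> S b -> S (op a b)),
      (forall a b c, S a -> S b -> S c -> op a (op b c) = op (op a b) c),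
      (forall a b, S a -> S b -> op a b = op b a)
    & (forall a, S a -> op e a = a)].

Definition mcancellative (T : Type) (S : T -> Prop) (op : T -> T -> T) :=
  forall a b c, S a -> S b -> S c -> op a b = op a c -> b = c.

Definition mdvd (T : Type) (S : T -> Prop) (op : T -> T -> T) (a b : T) :=
  exists c, S c /\ b = op a c.

Definition munit (T : Type) (S : T -> Prop) (op : T -> T -> T) (e : T) (u : T) :=
  S u /\ exists v, S v /\ op u v = e.

Definition mprime (T : Type) (S : T -> Prop) (op : T -> T -> T) (e : T) (p : T) :=
  [/\ S p, ~ munit S op e p &
      forall a b, S a -> S b -> mdvd S op p (op a b) ->
        mdvd S op p a \/ mdvd S op p b].

Definition mprod (T : Type) (op : T -> T -> T) (e : T) (l : list T) : T :=
  foldr op e l.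

Definition is_factorial (T : Type) (S : T -> Prop) (op : T -> T -> T) (e : T) :=
  [/\ is_cmonoid S op e, mcancellative S op &
      forall a, S a -> exists u (l : list T),
        [/\ munit S op e u, List.Forall (mprime S op e) l &
            a = op u (mprod op e l)]].

Definition is_mhom (H D : Type) (SH : H -> Prop) (opH : H -> H -> H) (eH : H)
  (SD : D -> Prop) (opD : D -> D -> D) (eD : D) (phi : H -> D) :=
  [/\ forall a, SH a -> SD (phi a), phi eH = eD &
      forall a b, SH a -> SH b -> phi (opH a b) = opD (phi a) (phi b)].

Definition is_divisor_hom (H D : Type) (SH : H -> Prop) (opH : H -> H -> H)
  (eH : H) (SD : D -> Prop) (opD : D -> D -> D) (eD : D) (phi : H -> D) :=
  is_mhom SH opH eH SD opD eD phi /\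
  forall a b, SH a -> SH b -> mdvd SD opD (phi a) (phi b) -> mdvd SH opH a b.

Definition is_krull_monoid (T : Type) (S : T -> Prop) (op : T -> T -> T) (e : T) :=
  [/\ is_cmonoid S op e, mcancellative S op &
      exists (D : Type) (SD : D -> Prop) (opD : D -> D -> D) (eD : D)
             (phi : T -> D),
        is_factorial SD opD eD /\ is_divisor_hom S op e SD opD eD phi].

Definition is_free_abelian (D : Type) (SD : D -> Prop) (opD : D -> D -> D)
  (eD : D) (P : D -> Prop) :=
  [/\ is_cmonoid SD opD eD, (forall p, P p -> SD p),
      (forall a, SD a -> exists l, List.Forall P l /\ a = mprod opD eD l) &
      (forall l1 l2, List.Forall P l1 -> List.Forall P l2 ->
         mprod opD eD l1 = mprod opD eD l2 -> Permutation.Permutation l1 l2)].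

Definition is_mgcd (D : Type) (SD : D -> Prop) (opD : D -> D -> D)
  (a : D) (l : list D) :=
  (forall b, List.In b l -> mdvd SD opD a b) /\
  (forall c, SD c -> (forall b, List.In b l -> mdvd SD opD c b) ->
     mdvd SD opD c a).

Definition is_divisor_theory (H D : Type) (SH : H -> Prop) (opH : H -> H -> H)
  (eH : H) (SD : D -> Prop) (opD : D -> D -> D) (eD : D) (P : D -> Prop)
  (phi : H -> D) :=
  [/\ is_divisor_hom SH opH eH SD opD eD phi,
      is_free_abelian SD opD eD P &
      forall a, SD a -> exists l : list H,
        List.Forall SH l /\ is_mgcd SD opD a (map phi l)].

(* Class group q(D)/q(phi(H)) of a divisor theory, presented as the set of
   pairs (a,b) in D x D (standing for a b^-1) modulo an equivalence. *)
Definition cl_carrier (D : Type) (SD : D -> Prop) (x : D * D) :=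
  SD x.1 /\ SD x.2.

Definition cl_eq (H D : Type) (SH : H -> Prop) (opD : D -> D -> D)
  (phi : H -> D) (x y : D * D) :=
  exists h h', [/\ SH h, SH h' &
    opD (opD x.1 y.2) (phi h) = opD (opD y.1 x.2) (phi h')].

Definition cl_mul (D : Type) (opD : D -> D -> D) (x y : D * D) :=
  (opD x.1 y.1, opD x.2 y.2).

Definition cl_of (D : Type) (eD : D) (p : D) : D * D := (p, eD).

Definition group_iso (A B : Type) (SA : A -> Prop) (eqA : A -> A -> Prop)
  (mulA : A -> A -> A) (SB : B -> Prop) (eqB : B -> B -> Prop)
  (mulB : B -> B -> B) (f : A -> B) :=
  [/\ forall x, SA x -> SB (f x),
      (forall x y, SA x -> SA y -> (eqA x y <-> eqB (f x) (f y))),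
      (forall z, SB z -> exists x, SA x /\ eqB (f x) z) &
      (forall x y, SA x -> SA y -> eqB (f (mulA x y)) (mulB (f x) (f y)))].

Definition infinite_set (T : Type) (P : T -> Prop) :=
  ~ exists l : list T, forall x, P x -> List.In x l.

Section Ideals.
Variable R : idomainType.
Local Notation K := {fraction R}.
Local Notation "x %:F" := (@FracField.tofrac R x).

Definition subRstar (X : R -> Prop) := forall a, X a -> a != 0.
Definition sincl (T : Type) (X Y : T -> Prop) := forall a, X a -> Y a.
Definition smulR (c : R) (X : R -> Prop) : R -> Prop :=
  fun a => exists x, X x /\ a = c * x.

Definition is_ideal_system (r : (R -> Prop) -> (R -> Prop)) :=
  [/\ forall X, subRstar X -> subRstar (r X),
      (forall X, subRstar X -> sincl X (r X)),
      (forall X Y, subRstar X -> subRstar Y -> sincl X (r Y) ->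
         sincl (r X) (r Y)),
      (forall a, a != 0 ->
         sincl (fun b => exists c, c != 0 /\ b = a * c) (r (fun b => b = a))) &
      (forall c X, c != 0 -> subRstar X ->
         forall a, smulR c (r X) a <-> r (smulR c X) a)].

Definition is_ring_ideal (J : R -> Prop) :=
  [/\ J 0, (forall a b, J a -> J b -> J (a + b)) &
      (forall a b, J b -> J (a * b))].

Definition rideals_are_ideals (r : (R -> Prop) -> (R -> Prop)) :=
  forall I, subRstar I -> (forall a, r I a <-> I a) ->
    is_ring_ideal (fun a => a = 0 \/ I a).

Definition dsys (X : R -> Prop) : R -> Prop :=
  fun a => a != 0 /\ exists l : seq (R * R),
    (forall p, List.In p l -> X p.2) /\ a = \sum_(p <- l) p.1 * p.2.

(* the v-system: X_v = (R : (R : X)) \ {0} *)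
Definition vsys (X : R -> Prop) : R -> Prop :=
  fun a => a != 0 /\
    forall z : K, (forall x, X x -> exists b, z * x%:F = b%:F) ->
      exists b, z * a%:F = b%:F.

Definition RstarK : K -> Prop := fun x => exists a : R, a != 0 /\ x = a%:F.

(* fractional extension: X_r = c^-1 (cX)_r for c in R\{0} with cX in R\{0} *)
Definition fcl (r : (R -> Prop) -> (R -> Prop)) (X : K -> Prop) : K -> Prop :=
  fun y => exists c : R, [/\ c != 0,
    (forall x, X x -> exists a : R, a != 0 /\ c%:F * x = a%:F) &
    exists b : R, y * c%:F = b%:F /\
      r (fun a => exists x, X x /\ a%:F = c%:F * x) b].

Definition is_frac_rideal (r : (R -> Prop) -> (R -> Prop)) (J : K -> Prop) :=
  [/\ (exists c : R, c != 0 /\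
         forall x, J x -> exists a : R, a != 0 /\ c%:F * x = a%:F),
      (exists x, J x) & fcl r J = J].

Definition is_rideal (r : (R -> Prop) -> (R -> Prop)) (I : K -> Prop) :=
  [/\ sincl I RstarK, (exists x, I x) & fcl r I = I].

Definition setmulK (X Y : K -> Prop) : K -> Prop :=
  fun z => exists x y, [/\ X x, Y y & z = x * y].

Definition rmul (r : (R -> Prop) -> (R -> Prop)) (X Y : K -> Prop) :=
  fcl r (setmulK X Y).

Definition r_invertible (r : (R -> Prop) -> (R -> Prop)) (I : K -> Prop) :=
  exists J, is_frac_rideal r J /\ rmul r I J = RstarK.

Definition Istar (r : (R -> Prop) -> (R -> Prop)) (I : K -> Prop) :=
  is_rideal r I /\ r_invertible r I.

Definition principal_ideal (I : K -> Prop) :=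
  exists a : R, a != 0 /\ I = fun x => exists b : R, b != 0 /\ x = (a * b)%:F.

Definition Fstar (r : (R -> Prop) -> (R -> Prop)) (J : K -> Prop) :=
  is_frac_rideal r J /\ r_invertible r J.

Definition scaleK (x : K) (A : K -> Prop) : K -> Prop :=
  fun z => exists a, A a /\ z = x * a.

(* equality in C_v(R)/C_r(R): [A] = [B][J] in C_v(R) for some J in C_r(R),
   i.e. xA = y (BJ)_v for some x,y in K^x and some r-invertible fractional
   r-ideal J *)
Definition CvCr_eq (r : (R -> Prop) -> (R -> Prop)) (A B : K -> Prop) :=
  exists J, Fstar r J /\ exists x y : K,
    [/\ x != 0, y != 0 & scaleK x A = scaleK y (rmul vsys B J)].

Definition Cv_eq (A B : K -> Prop) :=
  exists x y : K, [/\ x != 0, y != 0 & scaleK x A = scaleK y B].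

Definition is_prime_ideal (P : K -> Prop) :=
  [/\ is_rideal dsys P, ~ P 1 &
      forall a b : R, P (a * b)%:F -> P a%:F \/ P b%:F].

Definition height_one (P : K -> Prop) :=
  is_prime_ideal P /\
  forall Q, is_prime_ideal Q -> sincl Q P -> Q = P.

Definition krull_domain :=
  is_krull_monoid (fun a : R => a != 0) *%R 1.

End Ideals.

(* Main.v *)
(* Proof idea. Every r-closure lies below the divisorial one, so r-invertible
   r-ideals are v-invertible v-ideals, on which r- and v-multiplication agree and
   divisibility is containment. Hence a |-> aR and the inclusions
   H(R) -> I_r^*(R) -> I_v^*(R) are all divisor homomorphisms, and everything
   reduces to showing that I_v^*(R) is free on the height-one primes when R is
   Krull. A divisor homomorphism from R\{0} to a factorial monoid yields a family
   of additive functions w : R -> nat that detects divisibility and has finite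
   support at each element. It makes R completely integrally closed, so every
   v-ideal is v-invertible, and a v-ideal I is determined by the values min w(I),
   which gives the ascending chain condition on v-ideals; thus v-ideals factor
   into maximal v-ideals, which are exactly the height-one primes. Finally
   (A, B) |-> (A B^-1)_v identifies C(I_r^*(R)) with C_v(R)/C_r(R). *)
Require Import Defs.
From HB Require Import structures.
From mathcomp Require Import all_boot all_order all_algebra.
From mathcomp Require Import fraction boolp.
From Stdlib Require List Permutation.

Set Implicit Arguments.
Unset Strict Implicit.
Unset Printing Implicit Defensive.

Import GRing.Theory.
Local Open Scope ring_scope.

(** * Primes and their multiplicities in a factorial monoid *)

Section CommutativeMonoid.
Variables (T : Type) (S : T -> Prop) (op : T -> T -> T) (e : T).
Hypotheses (mon : is_cmonoid S op e) (can : mcancellative S op).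

Lemma mon1 : S e. Proof. by case: mon. Qed.
Lemma monM a b : S a -> S b -> S (op a b). Proof. by case: mon => _ h _ _ _; exact: h. Qed.
Lemma monA a b c : S a -> S b -> S c -> op a (op b c) = op (op a b) c.
Proof. by case: mon => _ _ h _ _; exact: h. Qed.
Lemma monC a b : S a -> S b -> op a b = op b a.
Proof. by case: mon => _ _ _ h _; exact: h. Qed.
Lemma mon1l a : S a -> op e a = a. Proof. by case: mon => _ _ _ _; exact. Qed.
Lemma mon1r a : S a -> op a e = a.
Proof. by move=> Sa; rewrite monC ?mon1l //; exact: mon1. Qed.
Lemma monCA a b c : S a -> S b -> S c -> op a (op b c) = op b (op a c).
Proof. by move=> Sa Sb Sc; rewrite monA // (monC Sa) // monA. Qed.

Lemma mprod_mem l : List.Forall S l -> S (mprod op e l).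
Proof. by elim=> [|a {}l Sa _ Sl]; [exact: mon1 | exact: monM]. Qed.

Lemma perm_mprod l1 l2 : Permutation.Permutation l1 l2 -> List.Forall S l1 ->
  mprod op e l1 = mprod op e l2.
Proof.
elim=> {l1 l2} [|a l1 l2 _ IH|a b l|l1 l2 l3 p12 IH1 _ IH2] //=.
- by move=> h; inversion h; subst; rewrite /= IH.
- move=> h; inversion h as [|? ? Sb h']; inversion h'; subst.
  by apply: monCA => //; exact: mprod_mem.
- move=> Sl; rewrite IH1 // IH2 //.
  exact: Permutation.Permutation_Forall p12 Sl.
Qed.

Lemma mdvd_refl a : S a -> mdvd S op a a.
Proof. by move=> Sa; exists e; split; [exact: mon1 | rewrite mon1r]. Qed.

(** As [q] is prime and divides [p v], it divides [p] or [v]. The first makes [v] a unit by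
    cancellation; the second would make [p] a unit. *)
Lemma mprime_associated p q : mprime S op e p -> mprime S op e q ->
  mdvd S op p q -> exists v, munit S op e v /\ q = op p v.
Proof.
move=> [Sp nup _] [Sq _ pq] [v [Sv qE]]; exists v; split => //.
have [[w [Sw pE]]|[w [Sw vE]]] : mdvd S op q p \/ mdvd S op q v.
- by apply: pq => //; rewrite -qE; exact: mdvd_refl.
- split=> //; exists w; split=> //; apply: (can Sp) => //; first exact: monM.
    exact: mon1.
  by rewrite monA // -qE -pE mon1r.
- case: nup; split=> //; exists w; split=> //.
  apply: (can Sv) => //; first exact: monM; first exact: mon1.
  by rewrite mon1r // {2}vE qE monA // (monC Sv).
Qed.

Lemma iter_mem p n x : S p -> S x -> S (iter n (op p) x).
Proof. by move=> Sp Sx; elim: n => //= n; exact: monM. Qed.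

Lemma iter_opl p n x y : S p -> S x -> S y ->
  op (iter n (op p) x) y = iter n (op p) (op x y).
Proof.
move=> Sp Sx Sy; elim: n => //= n <-; rewrite monA //; exact: iter_mem.
Qed.

Lemma iter_opr p n x y : S p -> S x -> S y ->
  op y (iter n (op p) x) = iter n (op p) (op y x).
Proof.
by move=> Sp Sx Sy; rewrite monC ?iter_opl 1?(monC Sy)//; exact: iter_mem.
Qed.

(** The multiplicity of [p] in [d], kept as a relation: cancellation alone makes [n] unique, while
    its existence needs factorization into primes. *)
Definition mval p d n :=
  exists x, [/\ S x, ~ mdvd S op p x & d = iter n (op p) x].

Lemma mval_inj p d n m : S p -> mval p d n -> mval p d m -> n = m.
Proof.
move=> Sp [x [Sx px ->]] [y [Sy py]].
elim: n m => [|n IH] [|m] //= xyE.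
- by case: px; exists (iter m (op p) y); split=> //; exact: iter_mem.
- by case: py; exists (iter n (op p) x); split=> //; exact: iter_mem.
- by congr _.+1; apply: IH; apply: (can Sp) xyE; exact: iter_mem.
Qed.

Lemma mval_op p a b n m : mprime S op e p ->
  mval p a n -> mval p b m -> mval p (op a b) (n + m)%N.
Proof.
move=> [Sp _ pp] [x [Sx px ->]] [y [Sy py ->]].
exists (op x y); split; first exact: monM.
- by move=> /(pp _ _ Sx Sy)[].
- by rewrite iter_opl ?iter_opr -?iterD //; exact: iter_mem.
Qed.

Lemma mval_unit p u : mprime S op e p -> munit S op e u -> mval p u 0%N.
Proof.
move=> [Sp nup _] [Su [v [Sv uv]]]; exists u; split=> // -[w [Sw uE]].
by case: nup; split=> //; exists (op w v); split; [exact: monM|rewrite monA // -uE].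
Qed.

Lemma mval_dvd p d n : S p -> mval p d n.+1 -> mdvd S op p d.
Proof.
by move=> Sp [x [Sx _ ->]]; exists (iter n (op p) x); split=> //; exact: iter_mem.
Qed.

Lemma mval_self p : mprime S op e p -> mval p p 1%N.
Proof.
move=> pp; have [Sp nup _] := pp; exists e; split; [exact: mon1| |by rewrite /= mon1r].
by move=> [v [Sv eE]]; case: nup; split=> //; exists v.
Qed.

(** Each factor [op p q] sheds its unit into the cofactor, which stays indivisible by [p]. *)
Lemma mval_associated p q d n : S p -> munit S op e q ->
  mval (op p q) d n -> mval p d n.
Proof.
move=> Sp [Sq [v [Sv qv]]] [x [Sx px ->]].
have {}px : ~ mdvd S op p x.
  move=> [y [Sy xE]]; case: px; exists (op v y); split; first exact: monM.
  by rewrite xE -monA ?(monA Sq) ?qv ?mon1l //; exact: monM.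
elim: n => [|n [y [Sy py /= ->]]]; first by exists x.
exists (op q y); split; first exact: monM.
- move=> [z [Sz yE]]; case: py; exists (op v z); split; first exact: monM.
  by rewrite monCA // -yE monA // (monC Sv) // qv mon1l.
- by rewrite -(monA Sp Sq (iter_mem n Sp Sy)) (iter_opr n Sp Sy Sq).
Qed.

Hypothesis fac : is_factorial S op e.

Lemma mval_prime_ex p q : mprime S op e p -> mprime S op e q ->
  exists n, mval p q n.
Proof.
move=> pp pq; have [Sq _ _] := pq.
have [/(mprime_associated pp pq)[v [uv ->]]|npq] := EM (mdvd S op p q).
  by exists (1 + 0)%N; apply: mval_op (mval_self pp) (mval_unit _ uv).
by exists 0%N, q.
Qed.

Lemma mval_ex p d : mprime S op e p -> S d -> exists n, mval p d n.
Proof.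
move=> pp Sd; have [_ _ /(_ _ Sd) [u [l [uu pl ->]]]] := fac.
suff [n nP] : exists n, mval p (mprod op e l) n.
  by exists (0 + n)%N; apply: mval_op => //; exact: mval_unit.
elim: l pl => [_|q l IH pl] /=.
  exists 0%N; apply: mval_unit => //; split; first exact: mon1.
  by exists e; split; [exact: mon1|rewrite mon1l //; exact: mon1].
have pq := List.Forall_inv pl; have pl' := List.Forall_inv_tail pl.
have [//|n nP] := IH; have [m mP] := mval_prime_ex pp pq.
by exists (m + n)%N; exact: mval_op.
Qed.

Lemma mprime_Forall l : List.Forall (mprime S op e) l -> List.Forall S l.
Proof. by apply: List.Forall_impl => p []. Qed.

(** Induction on [l]: the head has positive multiplicity in [d], so it splits off, and additivity
    carries the inequalities over to the quotient. *)
Lemma mprod_dvd l d : List.Forall (mprime S op e) l -> S d ->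
  (forall p n m, mprime S op e p -> mval p (mprod op e l) n -> mval p d m ->
     (n <= m)%N) ->
  mdvd S op (mprod op e l) d.
Proof.
elim: l d => [|q l IH] d pl Sd le_d.
  by exists d; split=> //=; rewrite mon1l.
have pq := List.Forall_inv pl; have pl' := List.Forall_inv_tail pl.
have [Sq _ _] := pq; have Sl := mprod_mem (mprime_Forall pl').
have [m mP] := mval_ex pq Sd; have [n nP] := mval_ex pq Sl.
have := le_d q _ _ pq (mval_op pq (mval_self pq) nP) mP.
case: m mP => // m /(mval_dvd Sq)[d' [Sd' dE]] _; subst d.
have [p n' m' pp n'P m'P|x [Sx ->]] := IH d' pl' Sd'.
  have [k kP] := mval_ex pp Sq.
  have := le_d p _ _ pp (mval_op pp kP n'P) (mval_op pp kP m'P).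
  by rewrite leq_add2l.
by exists x; split=> //=; rewrite monA.
Qed.

Lemma mval_le_dvd a b : S a -> S b ->
  (forall p n m, mprime S op e p -> mval p a n -> mval p b m -> (n <= m)%N) ->
  mdvd S op a b.
Proof.
move=> Sa Sb le_ab; have [_ _ /(_ _ Sa) [u [l [uu pl aE]]]] := fac.
have Sl := mprod_mem (mprime_Forall pl).
have [|x [Sx bE]] := mprod_dvd pl Sb.
  move=> p n m pp nP; apply: le_ab => //; rewrite aE.
  exact: mval_op (mval_unit pp uu) nP.
have [Su [v [Sv uv]]] := uu.
exists (op v x); split; first exact: monM.
rewrite bE aE (monC Su Sl) -monA ?(monA Su) ?uv ?mon1l //; exact: monM.
Qed.

Lemma mprime_dvd_mprod p l : mprime S op e p -> List.Forall (mprime S op e) l ->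
  mdvd S op p (mprod op e l) -> exists2 q, List.In q l & mdvd S op p q.
Proof.
move=> pp; have [Sp nup ppr] := pp; elim: l => [_ [v [Sv eE]]|q l IH pl].
  by case: nup; split=> //; exists v.
have pq := List.Forall_inv pl; have pl' := List.Forall_inv_tail pl; have [Sq _ _] := pq.
have Sl := mprod_mem (mprime_Forall pl').
case/ppr => // [dvd_q|]; first by exists q => //; left.
by case/IH => // q' ? ?; exists q' => //; right.
Qed.

Lemma mprime_dvd p d : mprime S op e p -> S d ->
  ~ mval p d 0 -> mdvd S op p d.
Proof. by move=> pp Sd h; apply: contrapT => npd; apply: h; exists d. Qed.

End CommutativeMonoid.

(** * Valuations that detect divisibility in a Krull domain *)

Section Valuations.
Variable R : idomainType.

(* Valuations are compared as functions: this makes the finiteness clause true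
   although a prime of the factorial monoid may have infinitely many associates. *)
Definition divisibility_valuations (V : (R -> nat) -> Prop) :=
  [/\ forall w a b, V w -> a != 0 -> b != 0 -> w (a * b) = (w a + w b)%N,
      forall a b, a != 0 -> b != 0 -> (forall w, V w -> (w a <= w b)%N) ->
        exists c, b = a * c &
      forall a, a != 0 ->
        exists L, forall w, V w -> w a <> 0%N -> List.In w L].

(** The valuations send [a] to the multiplicity of [p] in [phi a], for [p] a prime of the factorial
    monoid; they detect divisibility because [phi] is a divisor homomorphism. *)
Lemma krull_domain_valuations : krull_domain R ->
  exists V, divisibility_valuations V.
Proof.
move=> [mR cR [D [SD [op [e [phi [fac [[phiS phi1 phiM] dvd_phi]]]]]]]].
have [mon can _] := fac.
(* The value at 0 is a default, fixed so that [p] determines [w] and associated primes give equal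
   functions. *)
pose val p (w : R -> nat) :=
  w 0 = 0%N /\ forall a, a != 0 -> mval SD op p (phi a) (w a).
exists (fun w => exists2 p, mprime SD op e p & val p w).
split.
- move=> w a b [p pp [_ wP]] a0 b0; have [Sp _ _] := pp.
  apply: (mval_inj mon can Sp); first by apply: wP; rewrite mulf_neq0.
  by rewrite phiM //; apply: (mval_op mon pp); apply: wP.
- move=> a b a0 b0 le_ab; suff [c [_ ->]] : mdvd (fun a => a != 0) *%R a b.
    by exists c.
  apply: dvd_phi => //; apply: (mval_le_dvd mon can fac); try exact: phiS.
  move=> p n m pp nP mP; have [Sp _ _] := pp.
  have /choice[w wP] (x : R) : exists k,
      (x = 0 -> k = 0%N) /\ (x != 0 -> mval SD op p (phi x) k).
    have [->|x0] := eqVneq x 0; first by exists 0%N.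
    have [k kP] := mval_ex mon can fac pp (phiS _ x0).
    by exists k; split=> // x0'; rewrite x0' eqxx in x0.
  have vw : val p w by split=> [|x]; case: (wP 0) => // h _; [exact: h|case: (wP x)].
  have [_ vP] := vw.
  rewrite (mval_inj mon can Sp nP (vP _ a0)) (mval_inj mon can Sp mP (vP _ b0)).
  by apply: le_ab; exists p.
- move=> a a0; have [_ _ /(_ _ (phiS _ a0)) [u [l [uu pl aE]]]] := fac.
  (* A prime dividing [phi a] cannot divide the unit [u], so it divides a prime in [l]; it is enough
     to list the valuations at divisors of members of [l]. *)
  suff [L LP] : exists L, forall w p q, mprime SD op e p -> val p w ->
      List.In q l -> mdvd SD op p q -> List.In w L.
    exists L => w [p pp vw] wa0; have [Sp nup ppr] := pp; have [_ wP] := vw.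
    have Sl := mprod_mem mon (mprime_Forall pl).
    have : mdvd SD op p (phi a).
      apply: (mprime_dvd pp (phiS _ a0)).
      by move/(mval_inj mon can Sp (wP _ a0)).
    rewrite aE; case: uu => Su [v [Sv uv]].
    case/ppr => // [[y [Sy uE]]|].
      case: nup; split=> //; exists (op y v); split; first exact: (monM mon).
      by rewrite (monA mon) // -uE.
    by case/(mprime_dvd_mprod mon pp pl) => q ql pq; exact: (LP w p q).
  elim: l pl {aE} => [_|q l IH pl]; first by exists nil.
  case: IH; first exact: (List.Forall_inv_tail pl).
  move=> L LP; have pq := List.Forall_inv pl.
  (* All valuations at divisors of the prime [q] coincide. *)
  have [[w0 [p0 [pp0 vw0 dvd0]]]|no] := EM (exists w0 p0,
    [/\ mprime SD op e p0, val p0 w0 & mdvd SD op p0 q]); last first.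
    exists L => w p q' pp vw [<-|ql] pq1; last exact: (LP w p q').
    by case: no; exists w, p.
  exists (w0 :: L) => w p q' pp vw [<-|ql] pq1; last by right; exact: (LP w p q').
  left; apply: funext => x; have [->|x0] := eqVneq x 0.
    by case: vw vw0 => -> _ [-> _].
  have qval p' w' : mprime SD op e p' -> val p' w' -> mdvd SD op p' q ->
      forall k, mval SD op q (phi x) k -> k = w' x.
    move=> pp' [_ /(_ _ x0) vx] dvd_q k; have [Sp' _ _] := pp'.
    have [v [uv ->]] := mprime_associated mon can pp' pq dvd_q.
    by move/(mval_associated mon Sp' uv)/(mval_inj mon can Sp'); exact.
  have [k kP] := mval_ex mon can fac pq (phiS _ x0).
  by rewrite -(qval _ _ pp0 vw0 dvd0 _ kP) -(qval _ _ pp vw pq1 _ kP).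
Qed.

End Valuations.

(** * Fractional subsets of the quotient field and their inverses *)

Section FractionalSets.
Variable R : idomainType.
Local Notation K := {fraction R}.
Local Notation "x %:F" := (@FracField.tofrac R x).
Local Notation Rs := (@RstarK R).
Implicit Types (X Y Z : K -> Prop) (x y z : K).

Lemma fraction_quotient z : exists a b : R, b != 0 /\ z = a%:F / b%:F.
Proof.
elim/quotW: z => q; have q2 := denom_ratioP q; exists q.1, q.2; split=> //.
rewrite -[_ / _]/(FracField.mul _ (FracField.inv _)) !piE /FracField.mulf /FracField.invf.
by rewrite !numden_Ratio ?oner_neq0 ?mulr1 ?mul1r ?Ratio_numden.
Qed.

Lemma fraction_quotient_neq0 z : z != 0 ->
  exists a b : R, [/\ a != 0, b != 0 & z = a%:F / b%:F].
Proof.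
have [a [b [b0 ->]]] := fraction_quotient z; exists a, b; split=> //.
by apply: contraNneq H => ->; rewrite tofrac0 mul0r.
Qed.

Lemma RstarK_tofrac (a : R) : a != 0 -> Rs a%:F.
Proof. by exists a. Qed.

Lemma RstarK_neq0 x : Rs x -> x != 0.
Proof. by case=> a [a0 ->]; rewrite tofrac_eq0. Qed.

Lemma RstarK1 : Rs 1.
Proof. by exists 1; rewrite oner_neq0 tofrac1. Qed.

Lemma RstarKM x y : Rs x -> Rs y -> Rs (x * y).
Proof.
by move=> [a [a0 ->]] [b [b0 ->]]; exists (a * b); rewrite mulf_neq0 // tofracM.
Qed.

Lemma setmulKC X Y : setmulK X Y = setmulK Y X.
Proof.
by apply/predeqP => z; split=> -[x [y [? ? ->]]]; exists y, x; rewrite mulrC.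
Qed.

Lemma setmulKA X Y Z : setmulK X (setmulK Y Z) = setmulK (setmulK X Y) Z.
Proof.
apply/predeqP => u; split.
  move=> [x [_ [Xx [y [z [? ? ->]] ->]]]]; exists (x * y), z; rewrite mulrA.
  by split=> //; exists x, y.
move=> [_ [z [[x [y [? ? ->]] ? ->]]]]; exists x, (y * z); rewrite mulrA.
by split=> //; exists y, z.
Qed.

Lemma setmulKCA X Y Z : setmulK X (setmulK Y Z) = setmulK Y (setmulK X Z).
Proof. by rewrite setmulKA (setmulKC X) -setmulKA. Qed.

Lemma setmulKACA X Y Z U :
  setmulK (setmulK X Y) (setmulK Z U) = setmulK (setmulK X Z) (setmulK Y U).
Proof. by rewrite -!setmulKA (setmulKCA Y). Qed.

Lemma scaleK1 X : scaleK 1 X = X.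
Proof.
apply/predeqP => z; split=> [[x [Xx ->]]|Xz]; first by rewrite mul1r.
by exists z; rewrite mul1r.
Qed.

Lemma scaleKA x y X : scaleK x (scaleK y X) = scaleK (x * y) X.
Proof.
apply/predeqP => z; split.
  by move=> [_ [[u [Xu ->]] ->]]; exists u; rewrite mulrA.
by move=> [u [Xu ->]]; exists (y * u); rewrite mulrA; split=> //; exists u.
Qed.

Lemma scaleK_setmulK x X Y : scaleK x (setmulK X Y) = setmulK (scaleK x X) Y.
Proof.
apply/predeqP => z; split.
  move=> [_ [[u [v [Xu Yv ->]]] ->]]; exists (x * u), v; rewrite mulrA.
  by split=> //; exists u.
move=> [_ [v [[u [Xu ->]] Yv ->]]]; exists (u * v); rewrite mulrA.
by split=> //; exists u, v.
Qed.

Lemma scaleK_inj x X Y : x != 0 -> scaleK x X = scaleK x Y -> X = Y.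
Proof.
by move=> x0 /(congr1 (scaleK x^-1)); rewrite !scaleKA mulVf // !scaleK1.
Qed.

Lemma setmulK_mono X Y Z : sincl X Y -> sincl (setmulK X Z) (setmulK Y Z).
Proof. by move=> XY _ [x [z [Xx Zz ->]]]; exists x, z; split=> //; exact: XY. Qed.

(** Since [RstarK] omits 0, a fractional set omits 0 as well. *)
Definition fractional X := exists c : R, c != 0 /\ forall x, X x -> Rs (c%:F * x).

Lemma fractional_neq0 X x : fractional X -> X x -> x != 0.
Proof.
by move=> [c [_ cX]] /cX/RstarK_neq0; apply: contraNneq => ->; rewrite mulr0.
Qed.

Lemma fractional_integral X : sincl X Rs -> fractional X.
Proof.
move=> XR; exists 1; split; first exact: oner_neq0.
by move=> x /XR; rewrite tofrac1 mul1r.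
Qed.

Lemma fractional_mul X Y : fractional X -> fractional Y -> fractional (setmulK X Y).
Proof.
move=> [c [c0 cX]] [d [d0 dY]]; exists (c * d); split; first by rewrite mulf_neq0.
move=> _ [x [y [/cX Xx /dY Yy ->]]].
by rewrite tofracM mulrACA; exact: RstarKM.
Qed.

Lemma fractional_scale x X : x != 0 -> fractional X -> fractional (scaleK x X).
Proof.
move=> /fraction_quotient_neq0[a [b [a0 b0 ->]]] [c [c0 cX]].
exists (b * c); split; first by rewrite mulf_neq0.
move=> _ [y [/cX Xy ->]].
have -> : (b * c)%:F * (a%:F / b%:F * y) = a%:F * (c%:F * y).
  by rewrite tofracM mulrACA [b%:F * _]mulrC divfK ?tofrac_eq0 // mulrA.
by apply: RstarKM => //; exact: RstarK_tofrac.
Qed.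

(** This is [(R : X)] without 0; on fractional sets its double is the divisorial closure. *)
Definition inverseK X : K -> Prop := fun y => y != 0 /\ forall x, X x -> Rs (y * x).

Lemma inverseK_mono X Y : sincl X Y -> sincl (inverseK Y) (inverseK X).
Proof. by move=> XY y [y0 yY]; split=> // x /XY; exact: yY. Qed.

Lemma sub_inverseKK X : fractional X -> sincl X (inverseK (inverseK X)).
Proof.
move=> fX x Xx; split; first exact: fractional_neq0 fX Xx.
by move=> y [_ /(_ _ Xx)]; rewrite mulrC.
Qed.

Lemma fractional_inverseK X x : x != 0 -> X x -> fractional (inverseK X).
Proof.
move=> /fraction_quotient_neq0[a [b [a0 b0 ->]]] Xx; exists a; split=> // y [_ /(_ _ Xx) h].
have -> : a%:F * y = b%:F * (y * (a%:F / b%:F)).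
  by rewrite mulrCA [b%:F * _]mulrC divfK ?tofrac_eq0 // mulrC.
by apply: RstarKM h; exact: RstarK_tofrac.
Qed.

Lemma inverseK_inhabited X : fractional X -> exists y, inverseK X y.
Proof. by move=> [c [c0 cX]]; exists c%:F; rewrite /inverseK tofrac_eq0. Qed.

Lemma inverseK_nonempty X : (exists x, X x) -> fractional X -> fractional (inverseK X).
Proof.
by move=> [x Xx] fX; apply: (fractional_inverseK (fractional_neq0 fX Xx) Xx).
Qed.

Lemma inverseKKK X : (exists x, X x) -> fractional X ->
  inverseK (inverseK (inverseK X)) = inverseK X.
Proof.
move=> X0 fX; apply/predeqP => y; split.
  exact/inverseK_mono/sub_inverseKK.
exact/sub_inverseKK/inverseK_nonempty.
Qed.

End FractionalSets.

(** * Closure of fractional sets under an ideal system *)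

Section IdealSystem.
Variables (R : idomainType) (r : (R -> Prop) -> (R -> Prop)).
Hypothesis hr : is_ideal_system r.
Local Notation K := {fraction R}.
Local Notation "x %:F" := (@FracField.tofrac R x).
Local Notation Rs := (@RstarK R).
Implicit Types (X Y Z I J : K -> Prop) (x y z : K).

Local Notation scaled c X := (fun a : R => exists x : K, X x /\ a%:F = c%:F * x).
Local Notation clears c X := (forall x, X x -> Rs (c%:F * x)).

Lemma subRstar_scaled (c : R) X : clears c X -> subRstar (scaled c X).
Proof. by move=> cX a [x [/cX/RstarK_neq0 h aE]]; rewrite -tofrac_eq0 aE. Qed.

Lemma ideal_system_scale (c : R) (A : R -> Prop) : c != 0 -> subRstar A ->
  r (smulR c A) = smulR c (r A).
Proof. by move=> c0 A0; apply/predeqP => a; case: hr => _ _ _ _ h; split=> /h; apply. Qed.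

Lemma smulR_scaled (c d : R) X : clears d X ->
  smulR c (scaled d X) = scaled (c * d) X.
Proof.
move=> dX; apply/predeqP => a; split.
  by move=> [b [[x [Xx bE]] ->]]; exists x; rewrite !tofracM bE mulrA.
move=> [x [Xx aE]]; have [b [b0 bE]] := dX _ Xx.
exists b; split; first by exists x.
by apply/eqP; rewrite -tofrac_eq aE !tofracM -bE mulrA.
Qed.

(* The value of [fcl r X] does not depend on the choice of the denominator. *)
Lemma fclE (c : R) X y : c != 0 -> clears c X ->
  fcl r X y <-> exists b, y * c%:F = b%:F /\ r (scaled c X) b.
Proof.
move=> c0 cX; split; last by case=> b [? ?]; exists c; split=> //; exists b.
move=> [d [d0 dX [b [yd rb]]]].
have : smulR c (r (scaled d X)) (c * b) by exists b.
rewrite -ideal_system_scale //; last exact: subRstar_scaled.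
rewrite smulR_scaled // mulrC -smulR_scaled // ideal_system_scale //; last first.
  exact: subRstar_scaled.
move=> [b' [rb' E]]; exists b'; split=> //.
have d0' : d%:F != 0 by rewrite tofrac_eq0.
by apply: (mulfI d0'); rewrite -tofracM -E tofracM -yd mulrCA [RHS]mulrCA [d%:F * _]mulrC.
Qed.

Lemma fcl_clears (c : R) X : c != 0 -> clears c X -> clears c (fcl r X).
Proof.
move=> c0 cX y /(fclE _ c0 cX)[b [yc rb]]; rewrite mulrC yc.
by apply: RstarK_tofrac; case: hr => h _ _ _ _; exact: (h _ (subRstar_scaled cX)).
Qed.

Lemma fractional_fcl X : fractional X -> fractional (fcl r X).
Proof. by case=> c [c0 cX]; exists c; split=> //; exact: fcl_clears. Qed.

Lemma fcl_integral X : sincl X Rs -> sincl (fcl r X) Rs.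
Proof.
move=> XR y; have c1 : (1 : R) != 0 by exact: oner_neq0.
have X1 : clears 1 X by move=> x /XR; rewrite tofrac1 mul1r.
by move/(fcl_clears c1 X1); rewrite tofrac1 mul1r.
Qed.

Lemma sub_fcl X : fractional X -> sincl X (fcl r X).
Proof.
move=> [c [c0 cX]] x Xx; apply/(fclE _ c0 cX).
have [b [b0 bE]] := cX _ Xx; exists b; split; first by rewrite mulrC.
by case: hr => _ h _ _ _; apply: h; [exact: subRstar_scaled|exists x].
Qed.

Lemma fcl_min X Y : fractional Y -> sincl X (fcl r Y) -> sincl (fcl r X) (fcl r Y).
Proof.
move=> [c [c0 cY]] XY y.
have cX : clears c X by move=> x /XY; exact: fcl_clears.
move=> /(fclE _ c0 cX)[b [yc rb]]; apply/(fclE _ c0 cY); exists b; split=> //.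
case: hr => _ _ h _ _; apply: h rb; try exact: subRstar_scaled.
move=> a [x [/XY/(fclE _ c0 cY)[a' [xc ra']] aE]].
by suff -> : a = a' by []; apply/eqP; rewrite -tofrac_eq aE mulrC xc.
Qed.

Lemma fcl_mono X Y : fractional Y -> sincl X Y -> sincl (fcl r X) (fcl r Y).
Proof. by move=> fY XY; apply: fcl_min => // x /XY; exact: sub_fcl. Qed.

Lemma fcl_idem X : fractional X -> fcl r (fcl r X) = fcl r X.
Proof.
move=> fX; apply/predeqP => y; split; first exact: fcl_min.
by apply: sub_fcl; exact: fractional_fcl.
Qed.

(** Let [x = p/q] and let [c] be a denominator of [X]. Then [q c] is a denominator of [x X], and
    [(q c)(x X) = p (c X)], so compatibility with the scalar [p] of [R] suffices. *)
Lemma fcl_scale_sub x X : x != 0 -> fractional X ->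
  sincl (scaleK x (fcl r X)) (fcl r (scaleK x X)).
Proof.
move=> /fraction_quotient_neq0[p [q [p0 q0 ->]]] [c [c0 cX]] z.
move=> [y [/(fclE _ c0 cX)[b [yc rb]] ->]].
have q0' : q%:F != 0 by rewrite tofrac_eq0.
have E u : (q * c)%:F * (p%:F / q%:F * u) = p%:F * c%:F * u.
  by rewrite tofracM mulrACA [q%:F * _]mulrC divfK // mulrA.
exists (q * c); split; first by rewrite mulf_neq0.
  move=> _ [u [Xu ->]]; rewrite -[exists a, _]/(Rs _) E -mulrA; apply: RstarKM.
    exact: RstarK_tofrac.
  exact: cX.
exists (p * b); split; first by rewrite mulrC E -mulrA (mulrC c%:F) yc tofracM.
have : smulR p (r (scaled c X)) (p * b) by exists b.
rewrite -ideal_system_scale //; last exact: subRstar_scaled.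
rewrite smulR_scaled //; congr (r _ _); apply/predeqP => a; split.
  by move=> [u [Xu ->]]; exists (p%:F / q%:F * u); rewrite E tofracM; split=> //; exists u.
by move=> [_ [[u [Xu ->]] ->]]; exists u; rewrite E tofracM.
Qed.

Lemma fcl_scale x X : x != 0 -> fractional X -> fcl r (scaleK x X) = scaleK x (fcl r X).
Proof.
move=> x0 fX; apply/predeqP => y; split; last exact: fcl_scale_sub.
move=> h; exists (x^-1 * y); rewrite mulVKf //; split=> //.
have := @fcl_scale_sub x^-1 (scaleK x X); rewrite scaleKA mulVf // scaleK1; apply.
- by rewrite invr_eq0.
- exact: fractional_scale.
- by exists y.
Qed.

(** For each [y] in [Y], [y X_r = (y X)_r] lies in [(X Y)_r]; minimality of the closure does the
    rest. *)
Lemma fcl_setmulKl X Y : fractional X -> fractional Y ->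
  fcl r (setmulK (fcl r X) Y) = fcl r (setmulK X Y).
Proof.
move=> fX fY; have fXY := fractional_mul fX fY; apply/predeqP => z; split; last first.
  apply: fcl_mono; first by apply: fractional_mul => //; exact: fractional_fcl.
  exact/setmulK_mono/sub_fcl.
apply: fcl_min => // _ [x [y [Xx Yy ->]]]; rewrite mulrC.
have : fcl r (scaleK y X) (y * x).
  by rewrite fcl_scale //; [exists x|exact: fractional_neq0 fY Yy].
by apply: fcl_mono => // _ [u [Xu ->]]; exists u, y; rewrite mulrC.
Qed.

Lemma fcl_setmulKr X Y : fractional X -> fractional Y ->
  fcl r (setmulK X (fcl r Y)) = fcl r (setmulK X Y).
Proof. by move=> fX fY; rewrite setmulKC fcl_setmulKl // setmulKC. Qed.

Lemma fractional_RstarK : fractional Rs.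
Proof. exact: fractional_integral. Qed.

Lemma fcl_RstarK : fcl r Rs = Rs.
Proof.
apply/predeqP => y; split; first exact: fcl_integral.
exact/sub_fcl/fractional_RstarK.
Qed.

(** The axiom [bR] inside [{b}_r], applied to [b = c x] with [c] a denominator of [X], puts [R X]
    inside [X_r]. *)
Lemma fcl_RstarKM X : fractional X -> fcl r (setmulK Rs X) = fcl r X.
Proof.
move=> fX; have fRX := fractional_mul fractional_RstarK fX.
apply/predeqP => z; split; last first.
  apply: fcl_mono => // x Xx; exists 1, x; rewrite mul1r; split=> //; exact: RstarK1.
have [c [c0 cX]] := fX; apply: fcl_min => // _ [_ [x [[a [a0 ->]] Xx ->]]].
have [b [b0 bE]] := cX _ Xx; apply/(fclE _ c0 cX); exists (b * a).
split; first by rewrite tofracM -bE mulrC mulrA mulrAC.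
have sX := subRstar_scaled cX; have [_ _ h3 h4 _] := hr.
have sb : subRstar (fun d => d = b) by move=> d ->.
apply: (h3 (fun d => d = b)) => //.
  by move=> _ ->; case: hr => _ h _ _ _; apply: h => //; exists x.
by apply: h4 => //; exists a.
Qed.

Lemma fcl_RstarKl X a x : fractional X -> Rs a -> fcl r X x -> fcl r X (a * x).
Proof.
move=> fX Ra Xx; rewrite -fcl_idem // -fcl_RstarKM; last exact: fractional_fcl.
apply: sub_fcl; last by exists a, x.
by apply: fractional_mul (fractional_fcl fX); exact: fractional_RstarK.
Qed.

Lemma rmulC X Y : rmul r X Y = rmul r Y X.
Proof. by rewrite /rmul setmulKC. Qed.

Lemma rmulA X Y Z : fractional X -> fractional Y -> fractional Z ->
  rmul r X (rmul r Y Z) = rmul r (rmul r X Y) Z.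
Proof.
move=> fX fY fZ; have fXY := fractional_mul fX fY; have fYZ := fractional_mul fY fZ.
by rewrite /rmul fcl_setmulKl // fcl_setmulKr // setmulKA.
Qed.

Lemma rmul1 X : fractional X -> fcl r X = X -> rmul r Rs X = X.
Proof. by move=> fX X_r; rewrite /rmul fcl_RstarKM. Qed.

(** Every system lies below the divisorial one: if [z X] is integral, then so is
    [z X_r = (z X)_r]. *)
Lemma fcl_sub_inverseKK X : fractional X -> sincl (fcl r X) (inverseK (inverseK X)).
Proof.
move=> fX y ry; split; first exact: fractional_neq0 (fractional_fcl fX) ry.
move=> z [z0 zX]; rewrite mulrC; apply: (@fcl_integral (scaleK z X)).
  by move=> _ [x [Xx ->]]; exact: zX.
by rewrite fcl_scale //; exists y.
Qed.

(** * The group of r-invertible fractional r-ideals *)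

Lemma Fstar_fractional J : Fstar r J -> fractional J. Proof. by case=> -[]. Qed.
Lemma Fstar_fcl J : Fstar r J -> fcl r J = J. Proof. by case=> -[]. Qed.
Lemma Fstar_inhabited J : Fstar r J -> exists x, J x. Proof. by case=> -[]. Qed.

(** If [y I] is integral, then [y] lies in [y (I J)_r = (y I J)_r], hence in [(R J)_r = J]. The
    existential inverse in [r_invertible] is thus always [inverseK I], whatever the system. *)
Lemma rmul_inverseK I J : is_frac_rideal r I -> is_frac_rideal r J ->
  rmul r I J = Rs -> J = inverseK I.
Proof.
move=> [fI I0 I_r] [fJ J0 J_r] IJ; have fIJ := fractional_mul fI fJ.
apply/predeqP => y; split.
  move=> Jy; split; first exact: fractional_neq0 fJ Jy.
  move=> x Ix; rewrite -IJ; apply: sub_fcl => //; exists x, y; split=> //.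
  by rewrite mulrC.
move=> [y0 yI]; have /(fcl_scale y0) : fractional (setmulK I J) by [].
rewrite -/(rmul r I J) IJ => yR.
have : fcl r (scaleK y (setmulK I J)) y.
  by rewrite yR; exists 1; rewrite mulr1; split=> //; exact: RstarK1.
suff h : sincl (setmulK (scaleK y I) J) (setmulK Rs J).
  rewrite scaleK_setmulK => /(fcl_mono (fractional_mul fractional_RstarK fJ) h).
  by rewrite fcl_RstarKM // J_r.
by apply: setmulK_mono => _ [x [Ix ->]]; exact: yI.
Qed.

Lemma Fstar_rmul_inverseK J : Fstar r J -> rmul r J (inverseK J) = Rs.
Proof. by case=> hJ [I [hI IJ]]; rewrite -(rmul_inverseK hJ hI IJ). Qed.

Lemma Fstar_inverseK J : Fstar r J -> Fstar r (inverseK J).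
Proof.
case=> hJ [I [hI IJ]]; rewrite -(rmul_inverseK hJ hI IJ); split=> //.
by exists J; rewrite rmulC.
Qed.

Lemma Fstar_RstarK : Fstar r Rs.
Proof.
have h : is_frac_rideal r Rs.
  split; [exact: fractional_RstarK|by exists 1; exact: RstarK1|exact: fcl_RstarK].
by split=> //; exists Rs; split=> //; rewrite rmul1 ?fcl_RstarK //; exact: fractional_RstarK.
Qed.

Lemma is_frac_rideal_rmul I J : is_frac_rideal r I -> is_frac_rideal r J ->
  is_frac_rideal r (rmul r I J).
Proof.
move=> [fI [x Ix] I_r] [fJ [y Jy] J_r]; have fIJ := fractional_mul fI fJ.
split; [exact: fractional_fcl| |exact: fcl_idem].
by exists (x * y); apply: sub_fcl => //; exists x, y.
Qed.

Lemma rmulACA X Y Z U : fractional X -> fractional Y -> fractional Z -> fractional U ->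
  rmul r (rmul r X Y) (rmul r Z U) = rmul r (rmul r X Z) (rmul r Y U).
Proof.
move=> fX fY fZ fU.
have E A B C D : fractional A -> fractional B -> fractional C -> fractional D ->
    rmul r (rmul r A B) (rmul r C D) = fcl r (setmulK (setmulK A B) (setmulK C D)).
  move=> fA fB fC fD; have [fAB fCD] := (fractional_mul fA fB, fractional_mul fC fD).
  rewrite [LHS]fcl_setmulKl //; last exact: fractional_fcl.
  by rewrite fcl_setmulKr.
by rewrite !E // setmulKACA.
Qed.

Lemma Fstar_rmul I J : Fstar r I -> Fstar r J -> Fstar r (rmul r I J).
Proof.
move=> hI hJ; have [[fI' _ _] _] := Fstar_inverseK hI.
have [[fJ' _ _] _] := Fstar_inverseK hJ.
have [fI fJ] := (Fstar_fractional hI, Fstar_fractional hJ).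
split; first by apply: is_frac_rideal_rmul; [case: hI|case: hJ].
exists (rmul r (inverseK I) (inverseK J)); split.
  apply: is_frac_rideal_rmul; [by case: (Fstar_inverseK hI)|by case: (Fstar_inverseK hJ)].
rewrite rmulACA // !Fstar_rmul_inverseK // rmul1 ?fcl_RstarK //; exact: fractional_RstarK.
Qed.

Lemma Fstar_rmul1 J : Fstar r J -> rmul r Rs J = J.
Proof. by move=> hJ; rewrite rmul1 //; [exact: Fstar_fractional|exact: Fstar_fcl]. Qed.

Lemma Fstar_rmulA I J L : Fstar r I -> Fstar r J -> Fstar r L ->
  rmul r I (rmul r J L) = rmul r (rmul r I J) L.
Proof. by move=> hI hJ hL; apply: rmulA; exact: Fstar_fractional. Qed.

Lemma Fstar_rmulK I J : Fstar r I -> Fstar r J -> rmul r (inverseK I) (rmul r I J) = J.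
Proof.
move=> hI hJ; have hI' := Fstar_inverseK hI.
by rewrite Fstar_rmulA // (rmulC _ I) Fstar_rmul_inverseK // Fstar_rmul1.
Qed.

Lemma Fstar_rmulVK I J : Fstar r I -> Fstar r J -> rmul r I (rmul r (inverseK I) J) = J.
Proof.
move=> hI hJ; rewrite Fstar_rmulA ?Fstar_rmul_inverseK ?Fstar_rmul1 //.
exact: Fstar_inverseK.
Qed.

Lemma Fstar_rmulI I J L : Fstar r I -> Fstar r J -> Fstar r L ->
  rmul r I J = rmul r I L -> J = L.
Proof. by move=> hI hJ hL E; rewrite -(Fstar_rmulK hI hJ) E Fstar_rmulK. Qed.

Lemma Fstar_inverseK_uniq I J : Fstar r I -> Fstar r J -> rmul r I J = Rs -> J = inverseK I.
Proof. by case=> hI _ [hJ _]; exact: rmul_inverseK. Qed.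

Lemma Fstar_inverseKM I J : Fstar r I -> Fstar r J ->
  inverseK (rmul r I J) = rmul r (inverseK I) (inverseK J).
Proof.
move=> hI hJ; have [hI' hJ'] := (Fstar_inverseK hI, Fstar_inverseK hJ).
apply/esym/Fstar_inverseK_uniq; try exact: Fstar_rmul.
rewrite rmulACA; try exact: Fstar_fractional.
by rewrite !Fstar_rmul_inverseK // Fstar_rmul1 //; exact: Fstar_RstarK.
Qed.

Lemma scaleK_rmul x I J : x != 0 -> fractional I -> fractional J ->
  scaleK x (rmul r I J) = rmul r (scaleK x I) J.
Proof.
by move=> x0 fI fJ; rewrite /rmul -fcl_scale ?scaleK_setmulK //; exact: fractional_mul.
Qed.

Lemma Fstar_scale x I : x != 0 -> Fstar r I -> Fstar r (scaleK x I).
Proof.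
have h y J : y != 0 -> is_frac_rideal r J -> is_frac_rideal r (scaleK y J).
  move=> y0 [fJ [z Jz] J_r]; split; [exact: fractional_scale|by exists (y * z), z|].
  by rewrite fcl_scale // J_r.
move=> x0 [hI [J [hJ IJ]]]; split; first exact: h.
exists (scaleK x^-1 J); split; first by apply: h => //; rewrite invr_eq0.
have [[fI _ _] [fJ _ _]] := (hI, hJ).
rewrite -scaleK_rmul //; last by apply: fractional_scale => //; rewrite invr_eq0.
rewrite rmulC -scaleK_rmul ?invr_eq0 // scaleKA mulfV // scaleK1 rmulC //.
Qed.

Lemma scaleK_RstarK_rmul x I : x != 0 -> Fstar r I -> rmul r (scaleK x Rs) I = scaleK x I.
Proof.
move=> x0 hI; rewrite -scaleK_rmul ?Fstar_rmul1 //; first exact: fractional_RstarK.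
exact: Fstar_fractional.
Qed.

Lemma Fstar_closed I a x : Fstar r I -> Rs a -> I x -> I (a * x).
Proof.
move=> hI Ra; rewrite -(Fstar_fcl hI); apply: fcl_RstarKl => //.
exact: Fstar_fractional.
Qed.

(** * The monoid of integral r-invertible r-ideals *)

Lemma IstarP I : Istar r I <-> sincl I Rs /\ Fstar r I.
Proof.
split; first by case=> [[IR I0 I_r] inv]; do !split=> //; exact: fractional_integral.
by case=> IR [[_ I0 I_r] inv].
Qed.

Lemma Istar_principal (a : R) : a != 0 -> Istar r (scaleK a%:F Rs).
Proof.
move=> a0; apply/IstarP; split.
  by move=> _ [x [Rx ->]]; apply: RstarKM => //; exact: RstarK_tofrac.
by apply: Fstar_scale Fstar_RstarK; rewrite tofrac_eq0.
Qed.

Lemma Istar_RstarK : Istar r Rs.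
Proof. by apply/IstarP; split=> //; exact: Fstar_RstarK. Qed.

Lemma Istar_rmul I J : Istar r I -> Istar r J -> Istar r (rmul r I J).
Proof.
move=> /IstarP[IR hI] /IstarP[JR hJ]; apply/IstarP; split; last exact: Fstar_rmul.
by apply: fcl_integral => _ [x [y [/IR Rx /JR Ry ->]]]; exact: RstarKM.
Qed.

Lemma Istar_Fstar I : Istar r I -> Fstar r I. Proof. by case/IstarP. Qed.

Lemma Istar_monoid : is_cmonoid (Istar r) (rmul r) Rs.
Proof.
split; [exact: Istar_RstarK|exact: Istar_rmul| |by move=> *; exact: rmulC|].
- by move=> I J L /Istar_Fstar ? /Istar_Fstar ? /Istar_Fstar ?; exact: Fstar_rmulA.
- by move=> I /Istar_Fstar; exact: Fstar_rmul1.
Qed.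

Lemma Istar_cancellative : mcancellative (Istar r) (rmul r).
Proof. by move=> I J L /Istar_Fstar ? /Istar_Fstar ? /Istar_Fstar ?; exact: Fstar_rmulI. Qed.

(** To contain is to divide: when [J] lies in [I], the cofactor [(I^-1 J)_r] is integral. This
    criterion does not mention [r], which is what makes the inclusions divisor homomorphisms. *)
Lemma Istar_dvdP I J : Istar r I -> Istar r J ->
  mdvd (Istar r) (rmul r) I J <-> sincl J I.
Proof.
move=> /IstarP[IR hI] /IstarP[JR hJ]; have hI' := Fstar_inverseK hI; split.
  move=> [L [/IstarP[LR hL] ->]].
  rewrite -[X in sincl _ X](Fstar_rmul1 hI) (rmulC I L).
  apply: fcl_mono; last exact: setmulK_mono.
  by apply: fractional_mul (Fstar_fractional hI); exact: fractional_RstarK.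
move=> JI; exists (rmul r (inverseK I) J); split; last by rewrite Fstar_rmulVK.
apply/IstarP; split; last exact: Fstar_rmul.
by apply: fcl_integral => _ [x [y [[_ xI] /JI Iy ->]]]; exact: xI.
Qed.

End IdealSystem.

(** * The systems d and v, and the comparison of r with v *)

Section DivisorialSystem.
Variable R : idomainType.
Local Notation K := {fraction R}.
Local Notation "x %:F" := (@FracField.tofrac R x).
Local Notation Rs := (@RstarK R).
Local Notation v := (@vsys R).
Implicit Types (X Y Z I J : K -> Prop) (x y z : K).

Lemma is_ideal_system_dsys : is_ideal_system (@dsys R).
Proof.
split.
- by move=> X _ a [].
- move=> X X0 a Xa; split; first exact: X0.
  exists [:: (1, a)]; split; first by move=> p [<-|[]].
  by rewrite big_seq1 mul1r.
- move=> X Y X0 Y0 XY a [a0 [l [lX aE]]]; split=> //; rewrite {a}aE in a0 *.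
  elim: l lX {a0} => [|[c x] l IH] lX; first by exists [::]; rewrite !big_nil.
  have [|m [mY mE]] := IH; first by move=> p pl; apply: lX; right.
  have [_ [l' [l'Y /= xE]]] := XY _ (lX (c, x) (or_introl erefl)).
  exists ([seq (c * p.1, p.2) | p <- l'] ++ m); split.
    by move=> p /(List.in_app_or _ _ _)[/List.in_map_iff[q [<- /l'Y]]|/mY].
  rewrite big_cat big_cons -mE big_map xE mulr_sumr; congr (_ + _).
  by apply: eq_bigr => p _; rewrite mulrA.
- move=> a a0 _ [c [c0 ->]]; split; first by rewrite mulf_neq0.
  by exists [:: (c, a)]; split; [move=> p [<-|[]]|rewrite big_seq1 mulrC].
- move=> c X c0 X0 a; split.
    move=> [b [[b0 [l [lX bE]]] ->]]; split; first by rewrite mulf_neq0.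
    exists [seq (p.1, c * p.2) | p <- l]; split.
      by move=> p /List.in_map_iff[q [<- /lX Xq]]; exists q.2.
    by rewrite big_map bE mulr_sumr; apply: eq_bigr => p _; rewrite mulrCA.
  move=> [a0 [l [lX aE]]].
  suff [m [mX mE]] : exists m : seq (R * R), (forall p, List.In p m -> X p.2) /\
      \sum_(p <- l) p.1 * p.2 = c * \sum_(p <- m) p.1 * p.2.
    exists (\sum_(p <- m) p.1 * p.2); split; last by rewrite aE.
    split; last by exists m.
    by apply: contraNneq a0; rewrite aE mE => ->; rewrite mulr0.
  elim: l lX {aE} => [|[d x] l IH] lX; first by exists [::]; rewrite !big_nil mulr0.
  have [|m [mX mE]] := IH; first by move=> p pl; apply: lX; right.
  have [/= y [Xy ->]] := lX (d, x) (or_introl erefl).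
  exists ((d, y) :: m); split; first by move=> p [<-|/mX].
  by rewrite !big_cons mE mulrDr /= mulrCA.
Qed.

Lemma is_ideal_system_vsys : is_ideal_system v.
Proof.
split.
- by move=> X _ a [].
- by move=> X X0 a Xa; split; [exact: X0|move=> z; apply].
- move=> X Y X0 Y0 XY a [a0 aX]; split=> // z zY; apply: aX => x /XY[_]; exact.
- move=> a a0 _ [c [c0 ->]]; split; first by rewrite mulf_neq0.
  move=> z /(_ a erefl)[b zb]; exists (b * c).
  by rewrite !tofracM mulrA zb.
- move=> c X c0 X0 a; have c0' : c%:F != 0 by rewrite tofrac_eq0.
  split.
    move=> [b [[b0 bX] ->]]; split; first by rewrite mulf_neq0.
    move=> z zX; rewrite tofracM mulrA; apply: bX => x Xx.
    have [|d dE] := zX (c * x); first by exists x.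
    by exists d; rewrite -dE tofracM mulrA.
  (* Testing [a] against [1/c], which multiplies [c X] into [R], shows that [c] divides [a]. *)
  move=> [a0 aX]; have [|b ab] := aX c%:F^-1.
    by move=> _ [x [Xx ->]]; exists x; rewrite tofracM mulKf.
  have aE : a = c * b.
    by apply/eqP; rewrite -tofrac_eq tofracM -ab mulVKf.
  exists b; split=> //; split.
    by apply: contraNneq a0; rewrite aE => ->; rewrite mulr0.
  move=> z zX; have [|d dE] := aX (z / c%:F).
    move=> _ [x [Xx ->]]; have [d dE] := zX x Xx; exists d.
    by rewrite tofracM mulrA divfK.
  by exists d; rewrite -dE aE tofracM mulrA divfK.
Qed.

Let hv := is_ideal_system_vsys.

(** A denominator [c] of [X] lies in [X^-1], so [y c] is integral for [y] in the double inverse. If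
    [z] multiplies [c X] into [R], then [c z] lies in [X^-1] too, unless [z = 0], and [z (y c)] is
    integral. *)
Lemma fcl_vsys X : fractional X -> fcl v X = inverseK (inverseK X).
Proof.
move=> fX; apply/predeqP => y; split; first exact: fcl_sub_inverseKK.
have [c [c0 cX]] := fX; have c0' : c%:F != 0 by rewrite tofrac_eq0.
move=> [y0 yX]; apply/(fclE hv _ c0 cX).
have [|b [b0 yc]] := yX c%:F; first by split.
exists b; split=> //; split=> // z zX.
have [->|z0] := eqVneq z 0; first by exists 0; rewrite mul0r tofrac0.
have [|d [_ dE]] := yX (c%:F * z).
  split; first by rewrite mulf_neq0.
  move=> x Xx; have [a [a0 aE]] := cX _ Xx; have [|d dE] := zX a; first by exists x.
  exists d; rewrite mulrAC aE mulrC; split=> //.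
  by rewrite -tofrac_eq0 -dE mulf_neq0 ?tofrac_eq0.
by exists d; rewrite -yc mulrC -mulrA.
Qed.

(** An r-invertible [J] is the inverse of its inverse, hence divisorial; and [R = (J J^-1)_r] lies
    in [(J J^-1)_v], which is integral. *)
Lemma Fstar_vsys r J : is_ideal_system r -> Fstar r J -> Fstar v J.
Proof.
move=> hr hJ; have hJ' := Fstar_inverseK hr hJ.
have frac_v I : Fstar r I -> is_frac_rideal v I.
  move=> hI; have hI' := Fstar_inverseK hr hI.
  split; [exact: Fstar_fractional hI|exact: Fstar_inhabited hI|].
  have -> : I = inverseK (inverseK I).
    by apply: (Fstar_inverseK_uniq hr) => //; rewrite rmulC Fstar_rmul_inverseK.
  rewrite fcl_vsys; last exact: Fstar_fractional (Fstar_inverseK hr hI').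
  by rewrite inverseKKK //; [exact: Fstar_inhabited hI'|exact: Fstar_fractional hI'].
split; first exact: frac_v.
exists (inverseK J); split; first exact: frac_v.
have fJJ := fractional_mul (Fstar_fractional hJ) (Fstar_fractional hJ').
apply/predeqP => y; split.
  by apply: (fcl_integral hv) => _ [x [z [Jx [_ zJ] ->]]]; rewrite mulrC; exact: zJ.
rewrite -(Fstar_rmul_inverseK hr hJ) /rmul fcl_vsys //; exact: fcl_sub_inverseKK.
Qed.

Lemma Istar_vsys r J : is_ideal_system r -> Istar r J -> Istar v J.
Proof. by move=> hr /IstarP[JR hJ]; apply/IstarP; split=> //; exact: Fstar_vsys hJ. Qed.

(** The product [(I J)_r] is r-invertible, hence already divisorial, so it contains [(I J)_v]. *)
Lemma rmul_vsys r I J : is_ideal_system r -> Fstar r I -> Fstar r J ->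
  rmul r I J = rmul v I J.
Proof.
move=> hr hI hJ; have hIJ := Fstar_rmul hr hI hJ.
have fIJ := fractional_mul (Fstar_fractional hI) (Fstar_fractional hJ).
apply/predeqP => y; split.
  rewrite /rmul (fcl_vsys fIJ); exact: fcl_sub_inverseKK.
rewrite -(Fstar_fcl (Fstar_vsys hr hIJ)); apply: (fcl_mono hv).
  exact: Fstar_fractional hIJ.
exact: sub_fcl.
Qed.

End DivisorialSystem.

(** * Divisorial ideals in the presence of divisibility valuations *)

Lemma ltn_sum_In (T : Type) (L : list T) (f g : T -> nat) (t : T) :
  (forall s, f s <= g s)%N -> List.In t L -> (f t < g t)%N ->
  (\sum_(s <- L) f s < \sum_(s <- L) g s)%N.
Proof.
move=> le_fg; elim: L => [|s L IH] //=; rewrite !big_cons => -[->|tL] lt_fg.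
  by rewrite -addSn leq_add //; apply: leq_sum.
by rewrite -addnS leq_add //; exact: IH.
Qed.

Section Krull.
Variable R : idomainType.
Local Notation K := {fraction R}.
Local Notation "x %:F" := (@FracField.tofrac R x).
Local Notation Rs := (@RstarK R).
Local Notation v := (@vsys R).
Implicit Types (X Y Z I J P Q : K -> Prop) (x y z : K).
Variables (V : (R -> nat) -> Prop).
Hypothesis hV : divisibility_valuations V.

Let hv := is_ideal_system_vsys R.

Lemma valuationX w (a : R) n : V w -> a != 0 -> w (a ^+ n) = (n * w a)%N.
Proof.
move=> Vw a0; have [wM _ _] := hV; elim: n => [|n IH].
  have := wM w 1 1 Vw (oner_neq0 _) (oner_neq0 _); rewrite mulr1 expr0.
  by move/eqP; rewrite -{1}[w 1]addn0 eqn_add2l => /eqP <-.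
by rewrite exprS wM ?IH ?mulSn // expf_neq0.
Qed.

(** Let [z = a/b]. If [w a < w b], then integrality of [c z^n] forces [n <= w c], which fails at
    [n = w c + 1]. So [w b <= w a] for all valuations, and [b] divides [a]. *)
Lemma krull_completely_integrally_closed (c : R) z : c != 0 -> z != 0 ->
  (forall n, Rs (c%:F * z ^+ n)) -> Rs z.
Proof.
move=> c0 /fraction_quotient_neq0[a [b [a0 b0 ->]]] cz.
have [wM w_dvd _] := hV; have b0' : b%:F != 0 by rewrite tofrac_eq0.
have [||w Vw|d dE] := w_dvd b a => //.
  rewrite leqNgt; apply/negP => lt_ab.
  have [d [d0 /(congr1 (fun x => x * b%:F ^+ (w c).+1))]] := cz (w c).+1.
  rewrite expr_div_n mulrA divfK ?expf_neq0 // -!tofracXn -!tofracM.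
  move/eqP; rewrite tofrac_eq => /eqP /(congr1 w).
  rewrite !wM ?expf_neq0 // !valuationX // => E.
  have : ((w c).+1 * (w a).+1 <= (w c).+1 * w b)%N by rewrite leq_mul2l.
  rewrite mulnS => le1.
  have : ((w c).+1 + (w c).+1 * w a <= w c + (w c).+1 * w a)%N.
    by apply: leq_trans le1 _; rewrite E leq_addl.
  by rewrite leq_add2r ltnn.
exists d; rewrite dE tofracM mulrC mulKf //; split=> //.
by apply: contraNneq a0; rewrite dE => ->; rewrite mulr0.
Qed.

Lemma is_rideal_fractional I : is_rideal v I -> fractional I.
Proof. by case=> IR _ _; exact: fractional_integral. Qed.

Lemma is_rideal_inverseKK I : is_rideal v I -> inverseK (inverseK I) = I.
Proof. by move=> hI; rewrite -fcl_vsys; [case: hI|exact: is_rideal_fractional]. Qed.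

(** It must be shown that [z] is integral whenever [z I I^-1] is. Such a [z] maps [I^-1] into
    itself, so [z^n j] stays in [I^-1] for [j] in [I^-1]; with [i] in [I], the element [c = i j] is
    a common denominator of all powers of [z]. *)
Lemma krull_divisorial_invertible I : is_rideal v I -> Istar v I.
Proof.
move=> hI; have fI := is_rideal_fractional hI; have [IR I0 I_v] := hI.
have fI' := inverseK_nonempty I0 fI; have fII := fractional_mul fI fI'.
split=> //; exists (inverseK I); split.
  split=> //; first exact: inverseK_inhabited.
  by rewrite fcl_vsys // inverseKKK.
apply/predeqP => y; split.
  by apply: (fcl_integral hv) => _ [x [z [Ix [_ zI] ->]]]; rewrite mulrC; exact: zI.
move=> Ry; rewrite /rmul fcl_vsys //; split; first exact: RstarK_neq0.
move=> z [z0 zII]; apply: RstarKM => //.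
have [[i Ii] [j Ij]] := (I0, inverseK_inhabited fI).
have zj n : inverseK I (z ^+ n * j).
  elim: n => [|n [zj0 IH]]; first by rewrite mul1r.
  split=> [|x Ix]; first by rewrite exprS -mulrA mulf_neq0.
  rewrite exprS -!mulrA; apply: zII; exists x, (z ^+ n * j); split=> //.
  by rewrite mulrA mulrC.
have [_ /(_ _ Ii)[c [c0 cE]]] := Ij.
apply: (@krull_completely_integrally_closed c) => // n; rewrite -cE.
by rewrite mulrC mulrA; case: (zj n) => _; exact.
Qed.

(** * Least values and the ascending chain condition on divisorial ideals *)

Definition least_value I (w : R -> nat) n :=
  (exists a : R, I a%:F /\ w a = n) /\ forall a : R, I a%:F -> (n <= w a)%N.

Lemma least_value_ex I : is_rideal v I -> exists f, forall w, least_value I w (f w).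
Proof.
move=> [IR [x Ix] _]; have [|f fP] := @choice _ _ (least_value I); last by exists f.
move=> w; have [a [a0 xE]] := IR _ Ix; subst x.
have /ex_minnP[n /asboolP nP n_min] : exists n, `[< exists b : R, I b%:F /\ w b = n >].
  by exists (w a); apply/asboolP; exists a.
by exists n; split=> // b Ib; apply: n_min; apply/asboolP; exists b.
Qed.

(** Let [c/d] be in [I^-1] and let [a] in [I] attain the least value of [w]. Then [d] divides [c a],
    so [w d <= w c + w a <= w (c b)]. Hence [d] divides [c b], and [b] lies in the double inverse of
    [I]. *)
Lemma least_value_mem I f (b : R) : is_rideal v I ->
  (forall w, least_value I w (f w)) -> b != 0 ->
  (forall w, V w -> (f w <= w b)%N) -> I b%:F.
Proof.
move=> hI fP b0 le_fb; rewrite -(is_rideal_inverseKK hI).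
split; first by rewrite tofrac_eq0.
have [wM w_dvd _] := hV; have [IR _ _] := hI.
move=> _ [/fraction_quotient_neq0[c [d [c0 d0 ->]]] zI].
have d0' : d%:F != 0 by rewrite tofrac_eq0.
have [||w Vw|u uE] := w_dvd d (c * b) => //; first by rewrite mulf_neq0.
  have [[a [Ia aE]] _] := fP w.
  have [e [e0 eE]] := zI _ Ia; have a0 : a != 0 by rewrite -tofrac_eq0; exact/RstarK_neq0/IR.
  have : c * a = d * e.
    by apply/eqP; rewrite -tofrac_eq !tofracM -eE mulrA [d%:F * _]mulrC divfK.
  move/(congr1 w); rewrite !wM // aE => E.
  by rewrite (leq_trans (leq_addr (w e) _)) // -E leq_add2l le_fb.
exists u; split.
  by apply: contraTneq (mulf_neq0 c0 b0) => u0; rewrite uE u0 mulr0 eqxx.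
have -> : u%:F = (c * b)%:F / d%:F by rewrite uE tofracM mulrC mulKf.
by rewrite tofracM mulrA [b%:F * _]mulrC.
Qed.

(* Induction on the sum of the least values of [I], over the finitely many
   valuations that do not vanish at a fixed element of the initial ideal. *)
Lemma divisorial_ascending_induction (A : (K -> Prop) -> Prop) :
  (forall I, is_rideal v I ->
     (forall J, is_rideal v J -> sincl I J -> J <> I -> A J) -> A I) ->
  forall I, is_rideal v I -> A I.
Proof.
move=> step I0 hI0; have [I0R [x Ix] _] := hI0.
have [a0 [a0_0 xE]] := I0R _ Ix; subst x.
have [wM _ /(_ _ a0_0)[L LP]] := hV.
suff H n I f : is_rideal v I -> I a0%:F -> (forall w, least_value I w (f w)) ->
    (\sum_(w <- L) f w < n)%N -> A I.
  by have [f fP] := least_value_ex hI0; apply: (H _ _ f hI0 Ix fP) (leqnn _).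
elim: n I f => // n IH I f hI Ia fP lt_n; apply: step => // J hJ IJ neqJI.
have [g gP] := least_value_ex hJ.
have le_gf w : (g w <= f w)%N.
  by have [[a [Ia' <-]] _] := fP w; have [_ h] := gP w; exact/h/IJ.
apply: (IH _ _ hJ (IJ _ Ia) gP); rewrite -ltnS; apply: leq_trans lt_n; rewrite ltnS.
apply: contrapT => not_lt; apply: neqJI; apply/predeqP => y; split; last exact: IJ.
move=> Jy; have [JR _ _] := hJ; have [b [b0 yE]] := JR _ Jy; subst y.
apply: (least_value_mem hI fP) => // w Vw.
(* A valuation with [w b < f w] gives a strict drop from [f] to [g]. It occurs in [L], since
   [w a0 = 0] would force [f w = 0]. *)
rewrite leqNgt; apply/negP => lt_bf; apply: not_lt.
have [_ /(_ _ Jy) le_gb] := gP w; have lt_gf := leq_ltn_trans le_gb lt_bf.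
apply: (ltn_sum_In le_gf _ lt_gf); apply: LP => // wa0.
by have [_ /(_ _ Ia)] := fP w; rewrite wa0 leqn0 => /eqP fw0; rewrite fw0 in lt_bf.
Qed.

Lemma is_rideal_fcl_vsys X : sincl X Rs -> (exists x, X x) -> is_rideal v (fcl v X).
Proof.
move=> XR [x Xx]; have fX := fractional_integral XR; split.
- exact: fcl_integral.
- by exists x; exact: sub_fcl.
- exact: fcl_idem.
Qed.

(** Links the two systems: [is_prime_ideal] is stated with [dsys], the factorization with [vsys]. *)
Lemma divisorial_dsys I : is_rideal v I -> is_rideal (@dsys R) I.
Proof.
move=> hI; have fI := is_rideal_fractional hI; have [IR I0 _] := hI; split=> //.
apply/predeqP => y; split; last exact/sub_fcl/fI/is_ideal_system_dsys.
rewrite -{2}(is_rideal_inverseKK hI); apply: fcl_sub_inverseKK => //.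
exact: is_ideal_system_dsys.
Qed.

(** * Maximal divisorial ideals are the height-one primes *)

Definition maximal_divisorial P :=
  [/\ is_rideal v P, P <> Rs &
      forall J, is_rideal v J -> sincl P J -> J <> P -> J = Rs].

Lemma Istar_proper I : Istar v I -> I <> Rs -> ~ I 1.
Proof.
move=> hI neqI I1; apply: neqI; apply/predeqP => x; split.
  by case: hI => -[IR _ _] _; exact: IR.
move=> Rx; rewrite -[x]mulr1; apply: (Fstar_closed hv) => //.
exact: Istar_Fstar.
Qed.

(** Let [a b] be in [P] and [a] not. With [X = P + {a}] as a union, [X_v = R] by maximality and
    [b X] lies in [P], so [b] lies in [b R = (b X)_v], which lies in [P]. *)
Lemma maximal_divisorial_prime P : maximal_divisorial P -> is_prime_ideal P.
Proof.
move=> [hP neqP P_max]; have hP' := krull_divisorial_invertible hP.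
split; [exact: divisorial_dsys|exact: Istar_proper|move=> a b Pab].
have [Pa|nPa] := EM (P a%:F); [by left|right].
have [PR _ P_v] := hP; have := RstarK_neq0 (PR _ Pab).
rewrite tofracM mulf_eq0 negb_or => /andP[a0 b0].
pose X x := P x \/ x = a%:F.
have XR : sincl X Rs by move=> x [/PR//|->]; apply: RstarK_tofrac; rewrite -tofrac_eq0.
have fX := fractional_integral XR.
have Pb : sincl (scaleK b%:F X) (fcl v P).
  move=> _ [x [[Px|->] ->]]; rewrite P_v; last by rewrite mulrC -tofracM.
  apply: (Fstar_closed hv) => //; first exact: Istar_Fstar.
  by apply: RstarK_tofrac; rewrite -tofrac_eq0.
have XE : fcl v X = Rs.
  apply: P_max.
  - by apply: is_rideal_fcl_vsys => //; exists a%:F; right.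
  - by move=> x Px; apply: sub_fcl => //; left.
  - by move=> E; apply: nPa; rewrite -E; apply: sub_fcl => //; right.
rewrite -P_v; apply: (fcl_min hv (is_rideal_fractional hP) Pb).
by rewrite (fcl_scale hv b0 fX) XE; exists 1; rewrite mulr1; split=> //; exact: RstarK1.
Qed.

Lemma maximal_divisorial_ex I : is_rideal v I -> I <> Rs ->
  exists P, maximal_divisorial P /\ sincl I P.
Proof.
move: I; apply: divisorial_ascending_induction => I hI IH neqI.
have [I_max|] := EM (forall J, is_rideal v J -> sincl I J -> J <> I -> J = Rs).
  by exists I; split; [split|].
move=> /existsNP[J /not_implyP[hJ /not_implyP[IJ /not_implyP[neqJI neqJ]]]].
have [P [mP JP]] := IH J hJ IJ neqJI neqJ.
by exists P; split=> // x /IJ/JP.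
Qed.

(** A proper [I] lies in some maximal [P], so [I = (P J)_v]; here [J] is strictly larger than [I],
    because [J = I] would give [P = R] by cancellation. The label [A] allows a first use with
    maximal divisorial factors, before they are known to have height one. *)
Lemma divisorial_factorization (A : (K -> Prop) -> Prop) :
  (forall P, maximal_divisorial P -> A P) ->
  forall I, is_rideal v I -> exists l, List.Forall A l /\ I = mprod (rmul v) Rs l.
Proof.
move=> maxA; apply: divisorial_ascending_induction => I hI IH.
have [->|neqI] := EM (I = Rs); first by exists [::]; split=> //; constructor.
have [P [mP IP]] := maximal_divisorial_ex hI neqI.
have [hP neqP _] := mP; have hP' := krull_divisorial_invertible hP.
have hI' := krull_divisorial_invertible hI.
have /(Istar_dvdP hv hP' hI')[J [hJ IE]] := IP.
have IJ : sincl I J.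
  by apply/(Istar_dvdP hv hJ hI'); exists P; split=> //; rewrite rmulC.
have [||l [lA JE]] := IH J _ IJ; first by case: hJ.
  move=> JI; apply: neqP.
  apply: (Istar_cancellative hv hI') => //; first exact: Istar_RstarK.
  by rewrite [LHS]rmulC -{1}JI -IE [RHS]rmulC (Fstar_rmul1 hv (Istar_Fstar hI')).
by exists (P :: l); split; [constructor => //; exact: maxA|rewrite IE JE].
Qed.

(** The prime [Q] need not be divisorial, so the argument runs on elements: if [x] in the head [P]
    is outside [Q], then [x y] in [Q] puts every [y] of the remaining product in [Q]. *)
Lemma prime_contains_factor Q l : is_prime_ideal Q ->
  List.Forall (Istar v) l -> sincl (mprod (rmul v) Rs l) Q ->
  exists2 P, List.In P l & sincl P Q.
Proof.
move=> [[QR _ _] nQ1 pQ]; elim: l => [_ /(_ _ (RstarK1 R))//|P l IH hl lQ].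
have hP := List.Forall_inv hl; have {}hl := List.Forall_inv_tail hl.
have hm := mprod_mem (Istar_monoid hv) hl.
have [[x [Px nQx]]|sPQ] := EM (exists x, P x /\ ~ Q x); last first.
  exists P => [|x Px]; first by left.
  by apply: contrapT => nQx; apply: sPQ; exists x.
have [|P' P'l P'Q] := IH hl; last by exists P' => //; right.
move=> y my; have [[PR _ _] _] := hP; have [[mR _ _] _] := hm.
have [[a [_ xE]] [b [_ yE]]] := (PR _ Px, mR _ my).
have : Q (a * b)%:F.
  apply: lQ; apply: sub_fcl => //.
    by apply: fractional_mul; exact: fractional_integral.
  by exists x, y; split=> //; rewrite tofracM xE yE.
by case/pQ; rewrite -?xE -?yE // => /nQx.
Qed.

(** Factor [aR], for some [a] in [Q], into maximal divisorial ideals. *)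
Lemma prime_contains_maximal_divisorial Q : is_prime_ideal Q ->
  exists P, maximal_divisorial P /\ sincl P Q.
Proof.
move=> pQ; have [[QR [x Qx] Q_d] _ _] := pQ; have [a [a0 xE]] := QR _ Qx.
have haR := Istar_principal hv a0.
have [l [lmax aE]] := divisorial_factorization (fun P h => h) haR.1.
have [|||P Pl PQ] := @prime_contains_factor Q l => //.
- by apply: List.Forall_impl lmax => P [hP _ _]; exact: krull_divisorial_invertible.
- rewrite -aE => _ [y [Ry ->]]; rewrite mulrC -xE -Q_d.
  apply: fcl_RstarKl => //; first exact: is_ideal_system_dsys.
    exact: fractional_integral.
  by rewrite Q_d.
by exists P; split=> //; move/List.Forall_forall: lmax; apply.
Qed.

Lemma sincl_antisym X Y : sincl X Y -> sincl Y X -> X = Y.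
Proof. by move=> XY YX; apply/predeqP => x; split; [exact: XY|exact: YX]. Qed.

Lemma maximal_divisorial_sub P P' : maximal_divisorial P -> maximal_divisorial P' ->
  sincl P P' -> P = P'.
Proof.
move=> [_ _ P_max] [hP' neqP' _] PP'; apply: contrapT => neq; apply: neqP'.
by apply: P_max => // /esym.
Qed.

(** Every prime contains a maximal divisorial ideal, itself prime. Minimality of [P] gives one
    direction, incomparability of maximal divisorial ideals the other. *)
Lemma height_oneE P : height_one P <-> maximal_divisorial P.
Proof.
split=> [[pP P_min]|mP].
  have [P' [mP' P'P]] := prime_contains_maximal_divisorial pP.
  by rewrite -(P_min P') //; exact: maximal_divisorial_prime.
split=> [|Q pQ QP]; first exact: maximal_divisorial_prime.
have [P' [mP' P'Q]] := prime_contains_maximal_divisorial pQ.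
apply: sincl_antisym => //.
by rewrite -(maximal_divisorial_sub mP' mP) // => x /P'Q/QP.
Qed.

Lemma height_one_Istar P : height_one P -> Istar v P.
Proof. by case/height_oneE => hP _ _; exact: krull_divisorial_invertible. Qed.

Lemma Forall_height_one_Istar l : List.Forall (@height_one R) l -> List.Forall (Istar v) l.
Proof. by apply: List.Forall_impl; exact: height_one_Istar. Qed.

(** * Unique factorization of v-ideals and finite generation *)

Lemma height_one_factorization_uniq l1 l2 :
  List.Forall (@height_one R) l1 -> List.Forall (@height_one R) l2 ->
  mprod (rmul v) Rs l1 = mprod (rmul v) Rs l2 -> Permutation.Permutation l1 l2.
Proof.
have monv := Istar_monoid hv.
elim: l1 l2 => [|P l1 IH] l2 hl1 hl2 E.
  case: l2 hl2 E => [|P l2] hl2 E //; exfalso.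
  have hP := List.Forall_inv hl2; have [[_ nP1 _] _] := hP.
  have hm := mprod_mem monv (Forall_height_one_Istar (List.Forall_inv_tail hl2)).
  apply: nP1; suff /(Istar_dvdP hv (height_one_Istar hP) (Istar_RstarK hv)) :
      mdvd (Istar v) (rmul v) P Rs by apply; exact: RstarK1.
  by exists (mprod (rmul v) Rs l2).
have hP := List.Forall_inv hl1; have {}hl1 := List.Forall_inv_tail hl1.
have iP := height_one_Istar hP.
have hm1 := mprod_mem monv (Forall_height_one_Istar hl1).
(* The head [P] contains the second product, hence one of its factors, which equals [P] by
   minimality and can be cancelled. *)
have [P' P'l2 P'P] : exists2 P', List.In P' l2 & sincl P' P.
  have [pP _] := hP; apply: (prime_contains_factor pP (Forall_height_one_Istar hl2)).
  rewrite -E /=; apply/(Istar_dvdP hv iP); first exact: Istar_rmul.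
  by exists (mprod (rmul v) Rs l1).
have hP' : height_one P' by move/List.Forall_forall: hl2; apply.
have P'E : P' = P by case: hP => _; apply => //; case: hP'.
subst P'; have [la [lb l2E]] := List.in_split _ _ P'l2.
have perm2 : Permutation.Permutation l2 (P :: (la ++ lb)).
  by rewrite l2E; apply: Permutation.Permutation_sym; exact: Permutation.Permutation_middle.
have hl2' := Permutation.Permutation_Forall perm2 hl2.
have {}hl2' := List.Forall_inv_tail hl2'.
apply: Permutation.Permutation_trans (Permutation.Permutation_sym perm2).
constructor; apply: IH => //.
rewrite (perm_mprod monv perm2 (Forall_height_one_Istar hl2)) /= in E.
apply: (Istar_cancellative hv iP) E => //.
exact: (mprod_mem monv (Forall_height_one_Istar hl2')).
Qed.

Lemma Istar_vsys_free :
  is_free_abelian (Istar v) (rmul v) Rs (@height_one R).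
Proof.
split; [exact: Istar_monoid|exact: height_one_Istar| |exact: height_one_factorization_uniq].
by move=> I [hI _]; apply: divisorial_factorization => // P /height_oneE.
Qed.

Lemma height_one_mprime P : height_one P -> mprime (Istar v) (rmul v) Rs P.
Proof.
move=> hP; have iP := height_one_Istar hP; have [pP _] := hP; have [[PR _ _] nP1 _] := pP.
split=> //.
  move=> [_ [I [hI IE]]]; apply: nP1.
  have : sincl Rs P by apply/(Istar_dvdP hv iP (Istar_RstarK hv)); exists I.
  by apply; exact: RstarK1.
move=> I J hI hJ /(Istar_dvdP hv iP (Istar_rmul hv hI hJ)) IJP.
have [||L [<-|[<-|[]]] LP] := @prime_contains_factor P [:: I; J] pP.
- by apply: List.Forall_cons => //; apply: List.Forall_cons => //; exact: List.Forall_nil.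
- by rewrite /= [rmul v J _](rmulC v) (Fstar_rmul1 hv (Istar_Fstar hJ)).
- by left; apply/Istar_dvdP.
- by right; apply/Istar_dvdP.
Qed.

Lemma Istar_vsys_factorial : is_factorial (Istar v) (rmul v) Rs.
Proof.
split; [exact: Istar_monoid|exact: Istar_cancellative|move=> I hI].
have [_ _ /(_ _ hI)[l [hl IE]] _] := Istar_vsys_free.
have iR := Istar_RstarK hv.
exists Rs, l; split.
- by split=> //; exists Rs; split=> //; rewrite (Fstar_rmul1 hv (Istar_Fstar iR)).
- by apply: List.Forall_impl hl; exact: height_one_mprime.
- by rewrite -IE (Fstar_rmul1 hv (Istar_Fstar hI)).
Qed.

(** Supplies the finite sets needed for greatest common divisors. Ascending induction on [J = E_v]
    inside [I]: an element of [I] outside [J] is added to [E] and enlarges [J] strictly. *)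
Lemma divisorial_finitely_generated I : is_rideal v I ->
  exists E : list R, (forall a, List.In a E -> a != 0) /\
    I = fcl v (fun x => exists a, List.In a E /\ x = a%:F).
Proof.
move=> hI; have [IR [x0 Ix0] I_v] := hI; have [a0 [a0_0 x0E]] := IR _ Ix0; subst x0.
pose gen (E : list R) x := exists a, List.In a E /\ x = a%:F.
have genR E : (forall a, List.In a E -> a != 0) -> sincl (gen E) Rs.
  by move=> E0 _ [a [/E0 ? ->]]; exact: RstarK_tofrac.
suff H J : is_rideal v J -> (exists E, [/\ J = fcl v (gen E),
    (forall a, List.In a E -> a != 0) & sincl (gen E) I]) ->
    exists E, (forall a, List.In a E -> a != 0) /\ I = fcl v (gen E).
  have E0 a : List.In a [:: a0] -> a != 0 by case=> [<-|[]].
  apply: (H (fcl v (gen [:: a0]))).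
    by apply: is_rideal_fcl_vsys; [exact: genR|exists a0%:F, a0; split=> //; left].
  by exists [:: a0]; split=> // _ [_ [[<-|[]] ->]].
move: J; apply: divisorial_ascending_induction => J hJ IH [E [JE E0 EI]].
have fI := is_rideal_fractional hI.
have JI : sincl J I by rewrite JE -I_v; exact: fcl_mono.
have [[x [Ix nJx]]|sIJ] := EM (exists x, I x /\ ~ J x); last first.
  exists E; split=> //; rewrite -JE; apply: sincl_antisym => // x Ix.
  by apply: contrapT => nJx; apply: sIJ; exists x.
have [b [b0 xE]] := IR _ Ix; subst x.
have bE0 a : List.In a (b :: E) -> a != 0 by case=> [<-|/E0].
have bEI : sincl (gen (b :: E)) I.
  by move=> _ [a [[<-|aE] ->]] //; apply: EI; exists a.
have fbE := fractional_integral (genR _ bE0).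
apply: (IH (fcl v (gen (b :: E)))); last by exists (b :: E).
- by apply: is_rideal_fcl_vsys; [exact: genR|exists b%:F, b; split=> //; left].
- rewrite JE; apply: fcl_mono => // _ [a [aE ->]]; exists a; split=> //; by right.
- move=> EJ; apply: nJx; rewrite -EJ; apply: sub_fcl => //; exists b; split=> //; by left.
Qed.

End Krull.

(** * Transfer of the Krull property along divisor homomorphisms *)

Lemma krull_monoid_divisor_hom (H D : Type) (SH : H -> Prop) (opH : H -> H -> H) (eH : H)
  (SD : D -> Prop) (opD : D -> D -> D) (eD : D) (psi : H -> D) :
  is_cmonoid SH opH eH -> mcancellative SH opH ->
  is_divisor_hom SH opH eH SD opD eD psi ->
  is_krull_monoid SD opD eD -> is_krull_monoid SH opH eH.
Proof.
move=> mH cH [[psiS psi1 psiM] dvd_psi] [_ _ +].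
move=> [F [SF [opF [eF [phi [fac [[phiS phi1 phiM] dvd_phi]]]]]]].
split=> //; exists F, SF, opF, eF, (phi \o psi); split=> //; split.
  split=> [a /psiS/phiS//||a b Sa Sb /=]; first by rewrite /= psi1.
  by rewrite psiM // phiM //; exact: psiS.
by move=> a b Sa Sb /= /dvd_phi h; apply: dvd_psi => //; apply: h; exact: psiS.
Qed.

Section PrincipalIdeals.
Variable R : idomainType.
Local Notation K := {fraction R}.
Local Notation "x %:F" := (@FracField.tofrac R x).
Local Notation Rs := (@RstarK R).
Implicit Types (I J : K -> Prop).

Lemma nonzero_monoid : is_cmonoid (fun a : R => a != 0) *%R 1.
Proof.
split; first exact: oner_neq0.
- exact: mulf_neq0.
- by move=> *; rewrite mulrA.
- by move=> *; rewrite mulrC.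
- by move=> *; rewrite mul1r.
Qed.

Lemma nonzero_cancellative : mcancellative (fun a : R => a != 0) *%R.
Proof. by move=> a b c a0 _ _ /(mulfI a0). Qed.

Lemma principal_idealP I :
  principal_ideal I <-> exists a : R, a != 0 /\ I = scaleK a%:F Rs.
Proof.
have E (a : R) : (fun x => exists b : R, b != 0 /\ x = (a * b)%:F) = scaleK a%:F Rs.
  apply/predeqP => x; split.
    by move=> [b [b0 ->]]; exists b%:F; rewrite tofracM; split=> //; exists b.
  by move=> [_ [[b [b0 ->]] ->]]; exists b; rewrite tofracM.
by split=> -[a [a0 ->]]; exists a; rewrite E.
Qed.

Lemma principal_ideal_scaleK (a : R) : a != 0 -> principal_ideal (scaleK a%:F Rs).
Proof. by move=> a0; apply/principal_idealP; exists a. Qed.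

Section System.
Variable r : (R -> Prop) -> (R -> Prop).
Hypothesis hr : is_ideal_system r.

Lemma rmul_principal (a b : R) : a != 0 -> b != 0 ->
  rmul r (scaleK a%:F Rs) (scaleK b%:F Rs) = scaleK (a * b)%:F Rs.
Proof.
move=> a0 b0; rewrite scaleK_RstarK_rmul ?tofrac_eq0 //.
  by rewrite scaleKA tofracM.
exact/Istar_Fstar/Istar_principal.
Qed.

Lemma principal_ideal_Istar I : principal_ideal I -> Istar r I.
Proof. by move=> /principal_idealP[a [a0 ->]]; exact: Istar_principal. Qed.

(** Leaving [S] open between the principal ideals and [Istar r] covers both targets of the map from
    [a] to [aR]. *)
Lemma principal_divisor_hom (S : (K -> Prop) -> Prop) :
  (forall I, principal_ideal I -> S I) -> (forall I, S I -> Istar r I) ->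
  is_divisor_hom (fun a : R => a != 0) *%R 1 S (rmul r) Rs (fun a => scaleK a%:F Rs).
Proof.
move=> pS Sr; split.
  split.
  - by move=> a a0; apply/pS/principal_ideal_scaleK.
  - by rewrite tofrac1 scaleK1.
  - by move=> a b a0 b0; rewrite rmul_principal.
move=> a b a0 b0 [I [SI bE]].
have : sincl (scaleK b%:F Rs) (scaleK a%:F Rs).
  apply/(Istar_dvdP hr); try exact: Istar_principal.
  by exists I; split=> //; exact: Sr.
move/(_ b%:F)=> [|_ [[c [c0 ->]]]].
  by exists 1; rewrite mulr1; split=> //; exact: RstarK1.
by rewrite -tofracM => /eqP; rewrite tofrac_eq => /eqP bE'; exists c.
Qed.

Lemma principal_monoid : is_cmonoid (@principal_ideal R) (rmul r) Rs.
Proof.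
have [_ _ A C U] := Istar_monoid hr; have pI := principal_ideal_Istar.
split.
- by rewrite -[Rs]scaleK1 -tofrac1; apply: principal_ideal_scaleK; exact: oner_neq0.
- move=> _ _ /principal_idealP[a [a0 ->]] /principal_idealP[b [b0 ->]].
  by rewrite rmul_principal //; apply: principal_ideal_scaleK; rewrite mulf_neq0.
- by move=> I J L /pI ? /pI ? /pI ?; exact: A.
- by move=> I J /pI ? /pI ?; exact: C.
- by move=> I /pI ?; exact: U.
Qed.

Lemma principal_cancellative : mcancellative (@principal_ideal R) (rmul r).
Proof.
by move=> I J L /principal_ideal_Istar ? /principal_ideal_Istar ? /principal_ideal_Istar ?;
  exact: Istar_cancellative.
Qed.

Lemma inclusion_divisor_hom : is_divisor_hom (Istar r) (rmul r) Rs
  (Istar (@vsys R)) (rmul (@vsys R)) Rs (fun I => I).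
Proof.
have hv := is_ideal_system_vsys R; split.
  split=> // [I|I J /Istar_Fstar hI /Istar_Fstar hJ]; first exact: Istar_vsys.
  exact: rmul_vsys.
move=> I J hI hJ /(Istar_dvdP hv (Istar_vsys hr hI) (Istar_vsys hr hJ)) JI.
exact/Istar_dvdP.
Qed.

Lemma principal_inclusion_divisor_hom : is_divisor_hom (@principal_ideal R) (rmul r) Rs
  (Istar r) (rmul r) Rs (fun I => I).
Proof.
split; first by split=> // I; exact: principal_ideal_Istar.
move=> I J pI pJ /(Istar_dvdP hr (principal_ideal_Istar pI) (principal_ideal_Istar pJ)) JI.
case/principal_idealP: pI JI => a [a0 ->]; case/principal_idealP: pJ => b [b0 ->].
move=> /(_ b%:F)[|_ [[c [c0 ->]]]].
  by exists 1; rewrite mulr1; split=> //; exact: RstarK1.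
rewrite -tofracM => ->; exists (scaleK c%:F Rs); rewrite rmul_principal //.
by split=> //; exact: principal_ideal_scaleK.
Qed.

Lemma krull_Istar : krull_domain R -> is_krull_monoid (Istar r) (rmul r) Rs.
Proof.
move=> /krull_domain_valuations[V hV].
split; [exact: Istar_monoid|exact: Istar_cancellative|].
exists (K -> Prop), (Istar (@vsys R)), (rmul (@vsys R)), Rs, (fun I => I).
by split; [exact: Istar_vsys_factorial hV|exact: inclusion_divisor_hom].
Qed.

Lemma krull_domain_Istar : krull_domain R <-> is_krull_monoid (Istar r) (rmul r) Rs.
Proof.
split; first exact: krull_Istar.
apply: krull_monoid_divisor_hom; [exact: nonzero_monoid|exact: nonzero_cancellative|].
by apply: principal_divisor_hom => //; exact: principal_ideal_Istar.
Qed.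

Lemma krull_domain_principal :
  krull_domain R <-> is_krull_monoid (@principal_ideal R) (rmul r) Rs.
Proof.
split=> [/krull_Istar|].
  apply: krull_monoid_divisor_hom; [exact: principal_monoid|exact: principal_cancellative|].
  exact: principal_inclusion_divisor_hom.
apply: krull_monoid_divisor_hom; [exact: nonzero_monoid|exact: nonzero_cancellative|].
by apply: principal_divisor_hom => //; exact: principal_ideal_Istar.
Qed.

End System.
End PrincipalIdeals.

(** * The class group of the inclusion and the quotient of class groups *)

Section ClassGroup.
Variables (R : idomainType) (r : (R -> Prop) -> (R -> Prop)).
Hypothesis hr : is_ideal_system r.
Local Notation K := {fraction R}.
Local Notation "x %:F" := (@FracField.tofrac R x).
Local Notation Rs := (@RstarK R).
Local Notation v := (@vsys R).
Local Notation m := (rmul v).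
Implicit Types (A B C I J : K -> Prop).

Let hv := is_ideal_system_vsys R.

Lemma Fstar_rmul_cancel A B C : Fstar v A -> Fstar v B -> Fstar v C ->
  m (m A (inverseK B)) (m B C) = m A C.
Proof.
move=> hA hB hC; have hB' := Fstar_inverseK hv hB; have hBC := Fstar_rmul hv hB hC.
by rewrite -(Fstar_rmulA hv) // Fstar_rmulK.
Qed.

(** The two equations differ by the invertible factor [W], the product of the denominators [X2],
    [Y2] and [h]. *)
Lemma Fstar_ratio_eq X1 X2 Y1 Y2 h h' :
  Fstar v X1 -> Fstar v X2 -> Fstar v Y1 -> Fstar v Y2 -> Fstar v h -> Fstar v h' ->
  m (m X1 Y2) h = m (m Y1 X2) h' <->
  m X1 (inverseK X2) = m (m Y1 (inverseK Y2)) (m h' (inverseK h)).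
Proof.
move=> hX1 hX2 hY1 hY2 hh hh'.
have [iX2 iY2] := (Fstar_inverseK hv hX2, Fstar_inverseK hv hY2).
have ih := Fstar_inverseK hv hh.
have hL := Fstar_rmul hv hX1 iX2.
have hR := Fstar_rmul hv (Fstar_rmul hv hY1 iY2) (Fstar_rmul hv hh' ih).
pose W := m X2 (m Y2 h).
have hW : Fstar v W by apply: Fstar_rmul => //; exact: Fstar_rmul.
have E1 : m W (m X1 (inverseK X2)) = m (m X1 Y2) h.
  by rewrite rmulC Fstar_rmul_cancel ?(Fstar_rmulA hv) //; exact: Fstar_rmul.
have E2 : m W (m (m Y1 (inverseK Y2)) (m h' (inverseK h))) = m (m Y1 X2) h'.
  have -> : W = m Y2 (m h X2).
    by rewrite /W (Fstar_rmulA hv) // (rmulC v X2) -(Fstar_rmulA hv) // (rmulC v X2).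
  rewrite rmulC (rmulACA hv); try by apply: (@Fstar_fractional _ v) => //; exact: Fstar_rmul.
  rewrite Fstar_rmul_cancel // -(Fstar_rmulA hv hY1 iY2) // (rmulC v _ Y2).
  rewrite Fstar_rmul_inverseK // (rmulC v Y1) (Fstar_rmul1 hv hY1).
  by rewrite (rmulC v h') (Fstar_rmulA hv).
split=> [E|E]; last by rewrite -E1 -E2 E.
by apply: (Fstar_rmulI hv hW) => //; rewrite E1 E2.
Qed.

Definition class_ratio (x : (K -> Prop) * (K -> Prop)) := m x.1 (inverseK x.2).

Lemma Fstar_class_ratio x : cl_carrier (Istar v) x -> Fstar v (class_ratio x).
Proof.
by move=> [/Istar_Fstar h1 /Istar_Fstar h2]; apply: Fstar_rmul => //; exact: Fstar_inverseK.
Qed.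

(** Forwards, [J = h' h^-1]. Backwards, the principal factors are absorbed into [J'], and a
    denominator [c] writes [J'] as the quotient of the integral ideals [c J'] and [c R]. *)
Lemma cl_eq_class_ratio x y : cl_carrier (Istar v) x -> cl_carrier (Istar v) y ->
  cl_eq (Istar r) m (fun I : K -> Prop => I) x y <->
  CvCr_eq r (class_ratio x) (class_ratio y).
Proof.
move=> hx hy; have [/Istar_Fstar hx1 /Istar_Fstar hx2] := hx.
have [/Istar_Fstar hy1 /Istar_Fstar hy2] := hy; split.
  move=> [h [h' [/Istar_Fstar rh /Istar_Fstar rh']]].
  have [hh hh'] := (Fstar_vsys hr rh, Fstar_vsys hr rh').
  have ih := Fstar_inverseK hr rh.
  move/(Fstar_ratio_eq hx1 hx2 hy1 hy2 hh hh') => E.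
  exists (rmul r h' (inverseK h)); split; first exact: Fstar_rmul.
  exists 1, 1; rewrite oner_neq0 !scaleK1; split=> //.
  by rewrite rmul_vsys.
move=> [J [hJ [s [t [s0 t0 E]]]]].
have st0 : s^-1 * t != 0 by rewrite mulf_neq0 ?invr_eq0.
pose J' := scaleK (s^-1 * t) J; have hJ' : Fstar r J' by exact: Fstar_scale.
have {}E : class_ratio x = m (class_ratio y) J'.
  apply: (scaleK_inj s0); rewrite E.
  have fJ := Fstar_fractional hJ; have fy := Fstar_fractional (Fstar_class_ratio hy).
  rewrite [in RHS]rmulC -scaleK_rmul // scaleKA mulrA mulfV // mul1r.
  by rewrite [in RHS]rmulC.
have [c [c0 cJ]] := Fstar_fractional hJ'; have c0' : c%:F != 0 by rewrite tofrac_eq0.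
have hc := Istar_principal hr c0.
have hcJ : Istar r (scaleK c%:F J').
  by apply/IstarP; split; [move=> _ [u [Ju ->]]; exact: cJ|exact: Fstar_scale].
exists (scaleK c%:F Rs), (scaleK c%:F J'); split=> //.
have vc := Istar_Fstar (Istar_vsys hr hc); have vJ := Fstar_vsys hr hJ'.
have vcJ := Istar_Fstar (Istar_vsys hr hcJ).
apply/Fstar_ratio_eq => //; rewrite -/(class_ratio x) E /class_ratio; congr (m _ _).
by rewrite -(scaleK_RstarK_rmul hv c0' vJ) rmulC (Fstar_rmulK hv vc vJ).
Qed.

Lemma CvCr_eq_refl A : Fstar v A -> CvCr_eq r A A.
Proof.
move=> hA; exists Rs; split; first exact: Fstar_RstarK.
by exists 1, 1; rewrite oner_neq0 (rmulC v A) (Fstar_rmul1 hv hA).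
Qed.

Lemma class_ratio_RstarK A : Fstar v A -> class_ratio (A, Rs) = A.
Proof.
move=> hA; rewrite /class_ratio /=.
rewrite -(Fstar_rmul1 hv (Fstar_inverseK hv (Fstar_RstarK hv))).
by rewrite Fstar_rmul_inverseK ?(rmulC v A) ?Fstar_rmul1 //; exact: Fstar_RstarK.
Qed.

Lemma class_ratio_iso : group_iso (cl_carrier (Istar v))
  (cl_eq (Istar r) m (fun I : K -> Prop => I)) (cl_mul m)
  (Fstar v) (CvCr_eq r) m class_ratio.
Proof.
split; [exact: Fstar_class_ratio|exact: cl_eq_class_ratio| |].
  (* For surjectivity, a denominator makes [A] integral without changing its class. *)
  move=> A hA; have [c [c0 cA]] := Fstar_fractional hA.
  have c0' : c%:F != 0 by rewrite tofrac_eq0.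
  have hcA := Fstar_scale hv c0' hA.
  exists (scaleK c%:F A, Rs); split.
    split; last exact: Istar_RstarK.
    by apply/IstarP; split=> // _ [u [Au ->]]; exact: cA.
  exists Rs; split; first exact: Fstar_RstarK.
  exists 1, c%:F; rewrite oner_neq0 class_ratio_RstarK // scaleK1.
  by rewrite (rmulC v A) (Fstar_rmul1 hv hA).
move=> x y hx hy; have [/Istar_Fstar hx1 /Istar_Fstar hx2] := hx.
have [/Istar_Fstar hy1 /Istar_Fstar hy2] := hy.
suff -> : class_ratio (cl_mul m x y) = m (class_ratio x) (class_ratio y).
  by apply: CvCr_eq_refl; apply: Fstar_rmul => //; exact: Fstar_class_ratio.
rewrite /class_ratio /= Fstar_inverseKM // (rmulACA hv) //;
  by apply: (@Fstar_fractional _ v) => //; exact: Fstar_inverseK.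
Qed.

(** Equality in the v-class group implies equality in the quotient, with [J = R]; this carries prime
    divisors over. *)
Lemma Cv_eq_cl_eq x A : cl_carrier (Istar v) x -> Istar v A ->
  Cv_eq (class_ratio x) A -> cl_eq (Istar r) m (fun I : K -> Prop => I) (cl_of Rs A) x.
Proof.
move=> hx hA [s [t [s0 t0 E]]].
apply/cl_eq_class_ratio => //; first by split=> //; exact: Istar_RstarK.
have hA' := Istar_Fstar hA.
exists Rs; split; first exact: Fstar_RstarK.
exists t, s; rewrite /cl_of class_ratio_RstarK // -E.
by rewrite (rmulC v) (Fstar_rmul1 hv (Fstar_class_ratio hx)).
Qed.

End ClassGroup.

(** * The divisor theory and the assembled theorem *)

Lemma inclusion_divisor_theory (R : idomainType) (r : (R -> Prop) -> (R -> Prop)) :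
  is_ideal_system r -> krull_domain R ->
  is_divisor_theory (Istar r) (rmul r) (@RstarK R)
    (Istar (@vsys R)) (rmul (@vsys R)) (@RstarK R) (@height_one R)
    (fun I : {fraction R} -> Prop => I).
Proof.
move=> hr /krull_domain_valuations[V hV]; have hv := is_ideal_system_vsys R.
split; [exact: inclusion_divisor_hom|exact: Istar_vsys_free hV|move=> I hI].
have [E [E0 IE]] := divisorial_finitely_generated hV hI.1.
have princ a : List.In a E -> Istar r (scaleK (FracField.tofrac a) (@RstarK R)).
  by move/E0; exact: Istar_principal.
(* With [I = E_v], the ideals [aR] for [a] in [E] have [I] as greatest common divisor: a common
   divisor is a v-ideal containing [E], so it contains [I]. *)
exists (List.map (fun a => scaleK (FracField.tofrac a) (@RstarK R)) E); split.
  by apply/List.Forall_forall => _ /List.in_map_iff[a [<- /princ]].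
have fE : fractional (fun x => exists a, List.In a E /\ x = FracField.tofrac a).
  by apply: fractional_integral => _ [a [/E0 a0 ->]]; exact: RstarK_tofrac.
rewrite map_id; split=> [_ /List.in_map_iff[a [<- aE]]|C hC dvdC].
  apply/(Istar_dvdP hv hI (Istar_vsys hr (princ _ aE))) => _ [x [Rx ->]].
  rewrite mulrC; apply: (Fstar_closed hv (Istar_Fstar hI) Rx).
  by rewrite IE; apply: sub_fcl => //; exists a.
apply/(Istar_dvdP hv hC hI); rewrite IE -(Fstar_fcl (Istar_Fstar hC)).
apply: (fcl_mono hv (Fstar_fractional (Istar_Fstar hC))) => _ [a [aE ->]].
have /dvdC : List.In (scaleK (FracField.tofrac a) (@RstarK R))
    (List.map (fun a => scaleK (FracField.tofrac a) (@RstarK R)) E).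
  by apply/List.in_map_iff; exists a.
move/(Istar_dvdP hv hC (Istar_vsys hr (princ _ aE))); apply.
by exists 1; rewrite mulr1; split=> //; exact: RstarK1.
Qed.

Theorem theorem4p5 (R : idomainType) (r : (R -> Prop) -> (R -> Prop))
  (hr : is_ideal_system r) (hrid : rideals_are_ideals r) :
  [/\ (* (a) <-> (b) *)
      krull_domain R <->
        is_krull_monoid (@principal_ideal R) (rmul (@dsys R)) (@RstarK R),
      (* (a) <-> (c) *)
      krull_domain R <->
        is_krull_monoid (Istar (@dsys R)) (rmul (@dsys R)) (@RstarK R),
      (* (a) <-> (d) *)
      krull_domain R <-> is_krull_monoid (Istar r) (rmul r) (@RstarK R),
      (* (a) <-> (e) *)
      krull_domain R <->
        is_krull_monoid (Istar (@vsys R)) (rmul (@vsys R)) (@RstarK R) &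
      krull_domain R ->
      [/\ (* the inclusion I_r^*(R) -> I_v^*(R) is a divisor theory, whose
             prime divisors are the height-one primes *)
          is_divisor_theory (Istar r) (rmul r) (@RstarK R)
            (Istar (@vsys R)) (rmul (@vsys R)) (@RstarK R)
            (@height_one R) (fun I : {fraction R} -> Prop => I),
          (* C(I_r^*(R)) is isomorphic to C_v(R)/C_r(R) *)
          exists f : ({fraction R} -> Prop) * ({fraction R} -> Prop) ->
                     ({fraction R} -> Prop),
            group_iso (cl_carrier (Istar (@vsys R)))
              (cl_eq (Istar r) (rmul (@vsys R))
                 (fun I : {fraction R} -> Prop => I))
              (cl_mul (rmul (@vsys R)))
              (Fstar (@vsys R)) (CvCr_eq r) (rmul (@vsys R)) f,
          (* every class of C_v(R) contains a prime divisor =>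
             every class of C(I_r^*(R)) contains a prime divisor *)
          (forall A, Fstar (@vsys R) A ->
             exists p, height_one p /\ Cv_eq A p) ->
          forall x, cl_carrier (Istar (@vsys R)) x ->
            exists p, height_one p /\
              cl_eq (Istar r) (rmul (@vsys R))
                (fun I : {fraction R} -> Prop => I) (cl_of (@RstarK R) p) x &
          (* the same with "infinitely many" *)
          (forall A, Fstar (@vsys R) A ->
             infinite_set (fun p => height_one p /\ Cv_eq A p)) ->
          forall x, cl_carrier (Istar (@vsys R)) x ->
            infinite_set (fun p => height_one p /\
              cl_eq (Istar r) (rmul (@vsys R))
                (fun I : {fraction R} -> Prop => I) (cl_of (@RstarK R) p) x)]].

Proof.
have hv := is_ideal_system_vsys R; have hd := is_ideal_system_dsys R.
split; first exact: krull_domain_principal.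
1-3: exact: krull_domain_Istar.
move=> kR; have [V hV] := krull_domain_valuations kR; split.
- exact: inclusion_divisor_theory.
- by exists (@class_ratio R); exact: class_ratio_iso.
- move=> prime_in x hx; have [p [hp xp]] := prime_in _ (Fstar_class_ratio hx).
  exists p; split=> //; apply: Cv_eq_cl_eq => //; exact: height_one_Istar hV _ hp.
(* A finite list exhausting the primes in the class of [x] would also exhaust those in the finer
   v-class of [class_ratio x]. *)
- move=> inf_prime x hx [l lP]; apply: (inf_prime _ (Fstar_class_ratio hx)).
  exists l => p [hp xp]; apply: lP; split=> //.
  by apply: Cv_eq_cl_eq => //; exact: height_one_Istar hV _ hp.
Qed.
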